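(* Let $H(x,y)=\sum_{k=1}^{n}\sum_{j=0}^{k}a_{k,j}\,x^{k-j}y^{j}$ be a real polynomial of degree $n$, and let $X$ be a nonzero piecewise-smooth vector field on the torus $\mathbb{T}^2$, given on $[0,1]^2$ by $$X(x,y)=\begin{cases}X_H(x,y), & (x,y)\in(0,1)^2,\\ X_H(\pi(x,y)), & (x,y)\in\partial[0,1]^2,\end{cases}$$ with polynomial first integral $H$ and with discontinuity region $\Sigma=\partial[0,1]^2$, where $\pi:\partial[0,1]^2\to[0,1]^2$ is the projection that glues opposite edges. Assume: 1. $H(0,0)=0$; 2. for each $\mathbf{aba}$-type limit cycle $\gamma$ with transition points $p_1=(0,y_1)$, $p_2=(x_1,1)$, $p_3=(x_1,0)$, $p_4=(1,y_1)$: - $\min_{(x,y)\in\gamma}\|\nabla H(x,y)\|>0$; - (transversality at sewing points) $\langle X(p_i),n_{p_i}\rangle\neq 0$ for $i=1,2,3,4$, where $n_{p_i}$ is the inward-pointing unit normal to $\Sigma=\partial[0,1]^2$ at $p_i$. Then $X$ admits at most $n(n-1)$ limit cycles of type $\mathbf{aba}$.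
   Context: The torus $\mathbb{T}^2$ is the quotient of $[0,1]^2$ obtained by identifying opposite edges: $(x,0)\sim(x,1)$ and $(0,y)\sim(1,y)$. The set $\Sigma=\partial[0,1]^2$ is the switching (discontinuity) manifold: a trajectory reaching an edge reappears at the identified point of the opposite edge. $X_H$ denotes the Hamiltonian vector field $X_H=(-\partial_yH,\partial_xH)$, for which $H$ is a first integral (constant along orbits). Trajectories at $\Sigma$ follow Filippov's convention: near a point of $\Sigma$, with $\Sigma$ written locally as $\{h=0\}$ ($\nabla h\ne0$) and $X^{\pm}$ the vector fields on the two sides $\{\pm h>0\}$ (on the torus, the two sides of an edge are neighborhoods of the two identified points of opposite edges), the point lies in the sewing (crossing) region if $\langle X^+,\nabla h\rangle\,\langle X^-,\nabla h\rangle>0$, and trajectories then cross $\Sigma$. A (crossing) limit cycle is a closed orbit of $X$ on $\mathbb{T}^2$ that meets $\Sigma$ transversally at sewing points, and which is the unique closed orbit with this property in some neighborhood of itself. Type $\mathbf{aba}$: for some $x_1,y_1\in(0,1)$ the cycle consists of two trajectory arcs of $X_H$ inside the open square, one joining $p_1=(0,y_1)$ to $p_2=(x_1,1)$ and, after the identification $p_2\sim p_3=(x_1,0)$, one joining $p_3$ to $p_4=(1,y_1)$, closed up by $p_4\sim p_1$ (the whole loop traversed in either time direction). The first integral forces the closing equations $H(0,y_1)=H(x_1,1)$ and $H(x_1,0)=H(1,y_1)$. *)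

(* Defs.v *)
From HB Require Import structures.
From mathcomp Require Import all_boot all_order all_algebra generic_quotient.
From mathcomp Require Import all_classical all_reals all_analysis.
Import Order.TTheory GRing.Theory Num.Theory numFieldNormedType.Exports.

Set Implicit Arguments.
Unset Strict Implicit.
Unset Printing Implicit Defensive.

Local Open Scope classical_set_scope.
Local Open Scope ring_scope.

Section Plane.
Variable R : realType.
Implicit Types (p q u v : R * R) (H : R * R -> R).

Definition closed_square : set (R * R) :=
  [set p | 0 <= p.1 <= 1 /\ 0 <= p.2 <= 1].

Definition open_square : set (R * R) :=
  [set p | 0 < p.1 < 1 /\ 0 < p.2 < 1].

(* The projection gluing opposite edges: the identified points (x,0), (x,1),
   respectively (0,y), (1,y), are sent to (x,0), respectively (0,y); in
   particular the four corners are sent to (0,0). *)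
Definition glue_edges p : R * R :=
  (if p.1 == 1 then 0 else p.1, if p.2 == 1 then 0 else p.2).

Definition glue_rel (p q : closed_square) : bool :=
  glue_edges (set_val p) == glue_edges (set_val q).

Lemma glue_rel_refl : reflexive glue_rel.
Proof. by move=> p; exact: eqxx. Qed.

Lemma glue_rel_sym : symmetric glue_rel.
Proof. by move=> p q; exact: eq_sym. Qed.

Lemma glue_rel_trans : transitive glue_rel.
Proof. by move=> q p r /eqP pq /eqP qr; rewrite /glue_rel pq qr. Qed.

Canonical glue_equiv :=
  EquivRel glue_rel glue_rel_refl glue_rel_sym glue_rel_trans.

(* [0,1]^2 modulo ~, with the quotient of the subspace topology. *)
Definition torus : topologicalType :=
  quotient_topology {eq_quot glue_equiv}%qT.

Definition square_to_torus (p : closed_square) : torus :=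
  (\pi_torus p)%qT.

Definition torus_image (A : set (R * R)) : set torus :=
  square_to_torus @` (set_val @^-1` A).

Definition square_preimage (G : set torus) : set (R * R) :=
  set_val @` (square_to_torus @^-1` G).

Definition inner u v : R := u.1 * v.1 + u.2 * v.2.

Definition enorm u : R := Num.sqrt (inner u u).

Definition partial_x H p : R := derive1 (fun x => H (x, p.2)) p.1.

Definition partial_y H p : R := derive1 (fun y => H (p.1, y)) p.2.

Definition grad H p : R * R := (partial_x H p, partial_y H p).

Definition ham_field H p : R * R := (- partial_y H p, partial_x H p).

(* On the edges the value is the one at the glued representative, so that the
   field is single-valued on the torus; trajectories depend only on the field
   in the open square and on its one-sided limits at the edges. *)
Definition pw_field H p : R * R :=
  if p \in open_square then ham_field H p else ham_field H (glue_edges p).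

(* Near the class of (x,0) ~ (x,1), with x in (0,1), the set Sigma is {h = 0}
   with h(x,y) = y, and the fields on the sides h > 0 and h < 0 extend to
   X_H(x,0) and X_H(x,1) at that class; similarly for (0,y) ~ (1,y).  Corners,
   where Sigma is not a regular level set, are not sewing points. *)
Definition sewing H p : Prop :=
  [/\ 0 < p.1 < 1, p.2 = 0 \/ p.2 = 1 &
      0 < inner (ham_field H (p.1, 0)) (0, 1) * inner (ham_field H (p.1, 1)) (0, 1)]
  \/
  [/\ 0 < p.2 < 1, p.1 = 0 \/ p.1 = 1 &
      0 < inner (ham_field H (0, p.2)) (1, 0) * inner (ham_field H (1, p.2)) (1, 0)].

(* A is an arc of trajectory of X_H from p to q, traversed forward in time,
   whose points other than the endpoints lie in (0,1)^2. *)
Definition trajectory_arc H p q (A : set (R * R)) : Prop :=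
  exists (T : R) (phi : R -> R * R),
    [/\ 0 < T,
        {within `[0, T], continuous phi},
        forall t : R, 0 < t < T ->
          open_square (phi t) /\ is_derive t 1 phi (ham_field H (phi t)),
        phi 0 = p /\ phi T = q &
        A = phi @` `[0, T]].

(* A closed orbit on the torus made of m+1 >= 1 consecutive arcs: the i-th arc
   goes from p i to q i, and the trajectory reaching Sigma at q i reappears at
   the identified point p (i+1) of the opposite edge (indices mod m+1).  At a
   sewing point both one-sided fields are transversal to Sigma. *)
Definition crossing_closed_orbit H (G : set torus) : Prop :=
  exists (m : nat) (p q : 'I_m.+1 -> R * R) (A : 'I_m.+1 -> set (R * R)),
    [/\ forall i, trajectory_arc H (p i) (q i) (A i),
        forall i, sewing H (p i) /\ sewing H (q i),
        forall i, q i != p (ordS i) /\ glue_edges (q i) = glue_edges (p (ordS i)) &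
        G = torus_image (\bigcup_i A i)].

Definition limit_cycle H (G : set torus) : Prop :=
  crossing_closed_orbit H G /\
  exists U : set torus,
    [/\ open U, G `<=` U &
        forall G', crossing_closed_orbit H G' -> G' `<=` U -> G' = G].

(* The two disjuncts are the two time directions of the loop
   (0,y1) -> (x1,1) ~ (x1,0) -> (1,y1) ~ (0,y1). *)
Definition aba_type H (x1 y1 : R) (G : set torus) : Prop :=
  [/\ 0 < x1 < 1, 0 < y1 < 1 &
      exists A B : set (R * R),
        G = torus_image (A `|` B) /\
        (trajectory_arc H (0, y1) (x1, 1) A /\ trajectory_arc H (x1, 0) (1, y1) B \/
         trajectory_arc H (x1, 1) (0, y1) A /\ trajectory_arc H (1, y1) (x1, 0) B)].

Definition aba_limit_cycle H (G : set torus) : Prop :=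
  limit_cycle H G /\ exists x1 y1 : R, aba_type H x1 y1 G.

Definition is_min (S : set R) (m : R) : Prop := S m /\ lbound S m.

Definition poly_fun (n : nat) (a : nat -> nat -> R) p : R :=
  \sum_(1 <= k < n.+1) \sum_(0 <= j < k.+1)
     a k j * p.1 ^+ (k - j) * p.2 ^+ j.

End Plane.

(* Main.v *)
Require Import Defs.
From HB Require Import structures.
From mathcomp Require Import all_boot all_order all_algebra generic_quotient.
From mathcomp Require Import all_classical all_reals all_analysis.
From mathcomp Require Import perm zify ring lra.
Import Order.TTheory GRing.Theory Num.Theory numFieldNormedType.Exports.

(* Along a trajectory H is constant, so a cycle of type aba through (x1, y1)
   solves H(0,y) = H(x,1) and H(x,0) = H(1,y).  Subtracting the two equations
   kills the terms x^n and y^n, so the solutions are common zeros of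
   F(x,y) = H(x,1) - H(0,y), of degree at most n, and of a polynomial S of
   degree at most n - 1.

   The point (x1, y1) is an isolated solution: by continuous dependence of the
   flow on the starting point, and since both ends of each arc are transversal
   to the edges, any nearby solution (x, y) is joined by nearby arcs into a
   closed orbit, which contradicts the uniqueness of a limit cycle in a
   neighborhood.  If a common factor D of F and S vanished at (x1, y1), then
   F_x(x1, y1) <> 0 would make F / D nonzero there, so that all zeros of F near
   (x1, y1) would be zeros of S, and (x1, y1) would not be isolated.  Hence the
   (x1, y1) are common zeros of the coprime polynomials F / D and S / D, where
   D is a greatest common divisor, and the resultant, after a shear which
   separates the projections, has degree at most n (n - 1).  Finally
   (x1, y1) determines the cycle, by uniqueness of the trajectories. *)

Set Implicit Arguments.
Unset Strict Implicit.
Unset Printing Implicit Defensive.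

Local Open Scope ring_scope.

(** * Total degree and resultants *)

(** Two obstacles shape the argument. First, [F] and [S] may share a factor, and [S] may even vanish
    identically, so Bezout's bound is used in contrapositive form: more than n(n - 1) points leave
    one of them on a common factor, and isolation is invoked only there. The condition F_x <> 0
    comes from sewing: F_x(x1, y1) is the derivative of [H] along the top edge, which is the normal
    component of the field at (x1, 1). Second, a nearby solution of the closing equations is only a
    coincidence of values of [H] and has to be turned into arcs. The flow from the perturbed
    starting point reaches the target edge somewhere near the expected end. Since the normal
    component of X_H is, up to sign, the tangential derivative of [H], the function [H] is injective
    on that piece of edge, and its value picks out the right end. To let trajectories run past an
    edge, the field is extended beyond the square to a bounded Lipschitz one, whose solutions exist
    for all positive times. *)

Section WeightedDegree.
Variable F : fieldType.
Implicit Types (p q d : {poly {poly F}}) (m k : nat).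

(* [p(t, y)] is sent to [p(t s, s)], with [s] the outer variable, so that the
   total degree becomes the degree in [s]. *)
Definition homogenize p : {poly {poly F}} :=
  (map_poly (comp_poly ('X * 'X%:P) \o map_poly polyC) p).['X].

HB.instance Definition _ := GRing.RMorphism.copy homogenize
  (horner_eval 'X \o map_poly (comp_poly ('X * 'X%:P) \o map_poly polyC)).

Lemma homogenizeM p q : homogenize (p * q) = homogenize p * homogenize q.
Proof. exact: rmorphM. Qed.

Lemma coef_homogenizeC (a : {poly F}) k i :
  (poly_XmY a)`_k`_i = a`_i *+ (i == k).
Proof.
elim/poly_ind: a k i => [|a c IHa] k i.
  by rewrite /poly_XmY !rmorph0 !coef0 mul0rn.
rewrite /poly_XmY rmorphD rmorphM /= map_polyX map_polyC /=.
rewrite comp_polyD comp_polyM comp_polyX comp_polyC -/(poly_XmY a).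
rewrite mulrA !coefD coefMC !coefMX !coefC.
case: k => [|k] /=; case: i => [|i] /=; rewrite ?mul0r ?coefMX ?coef0 ?add0r ?mulr0n ?addr0 ?coefC //=.
by rewrite IHa eqSS.
Qed.

Lemma coef_homogenize p k i :
  (homogenize p)`_k`_i = p`_(k - i)`_i *+ (i <= k)%N.
Proof.
elim/poly_ind: p k i => [|p a IHp] k i; first by rewrite rmorph0 !coef0 mul0rn.
have -> : homogenize (p * 'X + a%:P) = homogenize p * 'X + poly_XmY a.
  by rewrite /homogenize rmorphD rmorphM /= map_polyX map_polyC /= !hornerE.
rewrite coefD coefD coef_homogenizeC coefMX coefD coefMX coefC.
case: k => [|k] /=.
  by rewrite coef0 !add0r leqn0; case: eqP => // ->.
rewrite IHp; case: (ltngtP i k.+1) => ik.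
- by rewrite -ltnS ik subSn //= !addr0.
- by rewrite leqNgt (ltnW ik) /= !mulr0n addr0.
- by rewrite ik ltnn subnn /= !add0r.
Qed.

(** Total degree at most [m]. The truncated subtraction forces the coefficients of index above [m]
    to vanish. *)
Definition wdeg m p := forall j : nat, (size (p`_j)%R <= m.+1 - j)%N.

Lemma wdegP m p : wdeg m p <-> (size (homogenize p) <= m.+1)%N.
Proof.
split=> [wp | hp j].
  apply/leq_sizeP => k mk; apply/polyP => i.
  rewrite coef_homogenize coef0; case: leqP => // ik; rewrite mulr1n nth_default //.
  by rewrite (leq_trans (wp _)) //; lia.
apply/leq_sizeP => i ji.
have := coef_homogenize p (i + j) i.
rewrite leq_addr addKn mulr1n => <-.
rewrite [(homogenize p)`_ _]nth_default ?coef0 //.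
by rewrite (leq_trans hp) // addnC -leq_subLR.
Qed.

Lemma homogenize_eq0 p : (homogenize p == 0) = (p == 0).
Proof.
apply/eqP/eqP => [hp|->]; last by rewrite rmorph0.
apply/polyP => j; apply/polyP => i.
have := coef_homogenize p (i + j) i.
by rewrite leq_addr addKn mulr1n => <-; rewrite hp !coef0.
Qed.

(** Since [homogenize] is an injective ring morphism into a domain, total degrees add up in
    products, and a cofactor cannot exceed the product. *)
Lemma wdeg_mulr_inv m d p : d != 0 -> wdeg m (d * p) -> wdeg m p.
Proof.
have [-> _ _|p0 d0] := eqVneq p 0; first by move=> j; rewrite coef0 size_poly0.
move=> /wdegP; rewrite homogenizeM size_mul ?homogenize_eq0 // => h; apply/wdegP.
have hd : (0 < size (homogenize d))%N by rewrite size_poly_gt0 homogenize_eq0.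
by rewrite (leq_trans _ h) // -(prednK hd) addSn leq_addl.
Qed.

Lemma wdegD m p q : wdeg m p -> wdeg m q -> wdeg m (p + q).
Proof.
by move=> wp wq j; rewrite coefD (leq_trans (size_polyD _ _)) // geq_max wp wq.
Qed.

Lemma wdegM m k p q : wdeg m p -> wdeg k q -> wdeg (m + k) (p * q).
Proof.
move=> /wdegP wp /wdegP wq; apply/wdegP; rewrite homogenizeM.
rewrite (leq_trans (size_polyMleq _ _)) // -subn1 leq_subLR.
by rewrite (leq_trans (leq_add wp wq)) // addSn addnS.
Qed.

Lemma wdeg_size m p : wdeg m p -> (size p <= m.+1)%N.
Proof.
move=> wp; apply/leq_sizeP => j mj; apply/eqP.
by rewrite -size_poly_leq0 (leq_trans (wp j)) //; lia.
Qed.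

(** In the product attached to a permutation [s], the weights [c (s i)] add up to the full sum of
    [c], so the bound does not depend on [s]. If no entry of the product vanishes, each [c (s i)] is
    at most [r i] and the truncated subtractions are exact. *)
Lemma size_det_weighted N (A : 'M[{poly F}]_N) (r c : 'I_N -> nat) :
  (forall i j, size (A i j) <= (r i).+1 - c j)%N ->
  (size (\det A) <= (\sum_i r i).+1 - \sum_i c i)%N.
Proof.
move=> Arc; rewrite /determinant (leq_trans (size_sum _ _ _)) //.
apply/bigmax_leqP => s _.
have -> (b : bool) (x : {poly F}) : size ((-1) ^+ b * x) = size x.
  by case: b; rewrite ?expr1 ?mulN1r ?size_polyN // expr0 mul1r.
have [A0|/existsPn A0] := boolP [exists i, A i (s i) == 0].
  by case/existsP: A0 => i /eqP Ai; rewrite (bigD1 i) //= Ai mul0r size_poly0.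
rewrite (leq_trans (size_poly_prod_leq _ _)) // cardT size_enum_ord.
have : (\sum_i size (A i (s i)) + \sum_i c i <= \sum_i r i + N)%N.
  rewrite [X in (_ + X)%N](reindex_inj (@perm_inj _ s)) /= -big_split /=.
  have -> : (\sum_i r i + N = \sum_(i < N) (r i + 1))%N.
    by rewrite big_split /= sum_nat_const card_ord muln1.
  apply: leq_sum => i _.
  have lt0 : (c (s i) < (r i).+1)%N.
    by rewrite -subn_gt0 (leq_trans _ (Arc i (s i))) // size_poly_gt0.
  by have := Arc i (s i); rewrite leq_subRL ?(ltnW lt0) // addn1 addnC.
move: (\sum_i size _)%N (\sum_i c i)%N (\sum_i r i)%N => x y z; lia.
Qed.

(** The rows alone would give [dq * m + dp * k], up to twice the wanted product. The column weights
    remove [dp * dq], and the rest is at most [m * k] because [(m - dp) * (k - dq)] is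
    nonnegative. *)
Lemma size_resultant m k p q : wdeg m p -> wdeg k q ->
  (size (resultant p q) <= (m * k).+1)%N.
Proof.
move=> wp wq; have sp := wdeg_size wp; have sq := wdeg_size wq.
set dp := (size p).-1; set dq := (size q).-1.
(* Row [l] of each block is a coefficient list shifted by [l], which raises its weight by [l]. *)
pose r (i : 'I_(dq + dp)) := match fintype.split i with
  | inl l => (m + l)%N | inr l => (k + l)%N end.
have /leq_trans -> // : (size (resultant p q) <=
    (\sum_i r i).+1 - \sum_(i < dq + dp) i)%N.
  apply: (size_det_weighted (c := fun j => nat_of_ord j)) => i j.
  rewrite Sylvester_mxE /r; case: (fintype.split i) => l.
    case: (boolP (l <= j)%N) => lj; last by rewrite /= mulr0n size_poly0.
    by rewrite /= mulr1n (leq_trans (wp _)) // subnBA // addSn.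
  case: (boolP (l <= j)%N) => lj; last by rewrite /= mulr0n size_poly0.
  by rewrite /= mulr1n (leq_trans (wq _)) // subnBA // addSn.
rewrite big_split_ord /= /r.
under eq_bigr => i _ do rewrite (unsplitK (inl i : 'I_dq + 'I_dp)%type).
under [X in (_ + X)%N]eq_bigr => i _ do
  rewrite (unsplitK (inr i : 'I_dq + 'I_dp)%type).
rewrite !big_split /= !sum_nat_const !card_ord.
rewrite [X in (_ - X)%N]big_split_ord /= big_split /= sum_nat_const card_ord.
set a := (\sum_i _)%N; set b := (\sum_i _)%N.
have lp : (dp <= m)%N by rewrite /dp; lia.
have lq : (dq <= k)%N by rewrite /dq; lia.
have : (dq * m + dp * k <= m * k + dp * dq)%N.
  rewrite -(subnK lp) -(subnK lq) !mulnDl !mulnDr.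
  have := leq0n ((m - dp) * (k - dq)).
  by rewrite [(dq * (m - dp))%N]mulnC [(dq * dp)%N]mulnC; lia.
by rewrite [(dp * dq)%N]mulnC; lia.
Qed.

End WeightedDegree.

(** * Common factors and Bezout's bound *)

Section WeightedDegree.
Variable F : fieldType.
Implicit Types (p q d : {poly {poly F}}) (m k : nat).

Lemma ltn_size_mul (A : idomainType) (p q : {poly A}) :
  (1 < size p)%N -> q != 0 -> (size q < size (p * q)%R)%N.
Proof.
move=> p1 q0; have p0 : p != 0 by rewrite -size_poly_gt0 ltnW.
by rewrite size_mul // -subn1 ltn_subRL ltn_add2r.
Qed.

Lemma irreducible_factor (c : {poly F}) : (1 < size c)%N ->
  exists2 h : {poly F}, irreducible_poly h & h %| c.
Proof.
have [N] := ubnP (size c); elim: N c => // N IH c cN c1.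
have [ci|] := asboolP (irreducible_poly c); first by exists c.
move=> /not_andP[]// /existsNP[q /not_implyP[q1 /not_implyP[qc nqc]]].
have c0 : c != 0 by rewrite -size_poly_gt0 ltnW.
have q0 : q != 0 by apply: dvdpN0 qc c0.
have sqc : (size q < size c)%N.
  rewrite ltn_neqAle dvdp_leq // andbT (dvdp_size_eqp qc).
  exact/negP.
have [||h hi hq] := IH q; first exact: leq_trans sqc _.
  by rewrite ltn_neqAle eq_sym q1 size_poly_gt0.
by exists h => //; apply: dvdp_trans hq qc.
Qed.

(** Gauss's lemma: if [i] and [j] are the first indices at which [h] fails to divide the
    coefficients of [p] and [q], then [h] divides every term of coefficient [i + j] of the product
    except one. *)
Lemma irreducible_dvd_coefs (h : {poly F}) p q : irreducible_poly h ->
  (forall i, h %| (p * q)`_i) ->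
  (forall i, h %| p`_i) \/ (forall i, h %| q`_i).
Proof.
move=> hi hpq.
have [hp|/existsNP hp] := asboolP (forall i, h %| p`_i); first by left.
have [hq|/existsNP hq] := asboolP (forall i, h %| q`_i); first by right.
have exP : exists i, ~~ (h %| p`_i) by case: hp => i /negP; exists i.
have exQ : exists i, ~~ (h %| q`_i) by case: hq => i /negP; exists i.
case: (ex_minnP exP) => i hpi imin; case: (ex_minnP exQ) => j hqj jmin.
have := hpq (i + j)%N; rewrite coefM.
have il : (i < (i + j).+1)%N by lia.
rewrite (bigD1 (Ordinal il)) //= addKn addrC dvdp_addr.
  rewrite Gauss_dvdpr; last by rewrite irreducible_poly_coprime.
  by rewrite (negPf hqj).
apply: (big_ind (fun x => h %| x)); first exact: dvdp0.
  by move=> x y; exact: dvdp_add.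
move=> l; rewrite -val_eqE /= => li.
case: (ltnP l i) => lti.
  apply: dvdp_mulr; apply: contraTT lti => nhl; rewrite -leqNgt; exact: imin.
apply: dvdp_mull; have ltl := ltn_ord l.
have : (i + j - l < j)%N by lia.
by apply: contraTT => nhl; rewrite -leqNgt; exact: jmin.
Qed.

Lemma dvd_coefsP (h : {poly F}) p : (forall i, h %| p`_i) ->
  exists p1, p = h *: p1.
Proof.
move=> hp; exists (\poly_(i < size p) (p`_i %/ h)).
apply/polyP => i; rewrite coefZ coef_poly; case: ltnP => ip.
  by rewrite mulrC divpK.
by rewrite mulr0 nth_default.
Qed.

(** Trivial content, tested on irreducible divisors so that no gcd of all coefficients has to be
    formed. *)
Definition primitive d := forall h : {poly F},
  irreducible_poly h -> ~ (forall i, h %| d`_i).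

(** Each extraction of an irreducible [h] lowers the degree of the leading coefficient, so the
    process stops. *)
Lemma primitive_part p : p != 0 ->
  exists (c : {poly F}) d, [/\ c != 0, primitive d & p = c *: d].
Proof.
have [N] := ubnP (size (lead_coef p)); elim: N p => // N IH p pN p0.
have [pp|] := asboolP (primitive p).
  by exists 1, p; rewrite oner_eq0 scale1r.
move=> /existsNP[h /not_implyP[hi /contrapT /dvd_coefsP[p1 pE]]].
have h0 := irredp_neq0 hi.
have p10 : p1 != 0 by apply: contraNneq p0; rewrite pE => ->; rewrite scaler0.
have [|//|c [d [c0 dp p1E]]] := IH p1.
  rewrite -ltnS (leq_trans _ pN) // ltnS pE lead_coefZ.
  by apply: ltn_size_mul; rewrite ?lead_coef_eq0 //; case: hi.
by exists (h * c), d; split; rewrite ?mulf_neq0 // pE p1E scalerA.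
Qed.

(** The irreducible factors of [c] cannot divide [d], so by Gauss's lemma they are removed from [e]
    one at a time, until [c] is a nonzero constant. *)
Lemma gauss_primitive_dvd d (c : {poly F}) p e : primitive d -> c != 0 ->
  c *: p = e * d -> exists e1, p = e1 * d.
Proof.
move=> dprim; have [N] := ubnP (size c); elim: N c e => // N IH c e cN c0 cE.
case: (ltnP 1 (size c)) => c1; last first.
  have /size_poly1P[a a0 ca] : size c == 1%N.
    by rewrite eqn_leq c1 size_poly_gt0.
  exists ((a^-1)%:P *: e); rewrite -scalerAl -cE scalerA ca -polyCM mulVf //.
  by rewrite scale1r.
have [h hi hc] := irreducible_factor c1.
have [|//|] := @irreducible_dvd_coefs h e d hi.
- by move=> i; rewrite -cE coefZ dvdp_mulr.
- move=> /dvd_coefsP[e1 e1E]; have h0 := irredp_neq0 hi.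
  have [c' cq] : exists c', c = h * c' by exists (c %/ h); rewrite mulrC divpK.
  have q0 : c' != 0 by apply: contraNneq c0; rewrite cq => ->; rewrite mulr0.
  apply: (IH c' e1) => //.
    rewrite -ltnS (leq_trans _ cN) // ltnS cq.
    by apply: ltn_size_mul => //; case: hi.
  by apply: (@mulfI _ h%:P); rewrite ?polyC_eq0 // !mul_polyC scalerA -cq cE e1E scalerAl.
- by move=> hd; case: (dprim h hi hd).
Qed.

(** Over the coefficient ring [{poly F}] a gcd is determined only up to factors from that ring and
    need not divide exactly; its primitive part does. It is split off repeatedly, with [size p]
    decreasing, until the resultant no longer vanishes. *)
Lemma coprime_cofactors m k p q : p != 0 -> q != 0 -> wdeg m p -> wdeg k q ->
  exists d p1 q1, [/\ p = d * p1, q = d * q1, wdeg m p1, wdeg k q1 &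
                      resultant p1 q1 != 0].
Proof.
have [N] := ubnP (size p); elim: N p q => // N IH p q pN p0 q0 wp wq.
have [r0|r0] := eqVneq (resultant p q) 0; last first.
  by exists 1, p, q; rewrite !mul1r.
have g1 : (1 < size (gcdp p q))%N by rewrite -resultant_eq0 r0.
have g0 : gcdp p q != 0 by rewrite -size_poly_gt0 ltnW.
have [c [d [c0 dprim gE]]] := primitive_part g0.
have sd : (1 < size d)%N by move: g1; rewrite gE size_scale.
have d0 : d != 0 by rewrite -size_poly_gt0 ltnW.
have dvd_d r : gcdp p q %| r -> exists e, r = e * d.
  (* Divisibility here is pseudo-divisibility: it yields an identity only after scaling by a nonzero
     [b]. *)
  move=> /Pdiv.Idomain.dvdpP[[b e]] /= b0; rewrite gE -scalerAr scalerAl.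
  exact: gauss_primitive_dvd.
have [e pE] := dvd_d p (dvdp_gcdl p q).
have [f qE] := dvd_d q (dvdp_gcdr p q).
have e0 : e != 0 by apply: contraNneq p0; rewrite pE => ->; rewrite mul0r.
have f0 : f != 0 by apply: contraNneq q0; rewrite qE => ->; rewrite mul0r.
have [|//|//|||d1 [p1 [q1 [eE fE wp1 wq1 r1]]]] := IH e f.
- by rewrite -ltnS (leq_trans _ pN) // ltnS pE mulrC ltn_size_mul.
- by apply: (wdeg_mulr_inv d0); rewrite mulrC -pE.
- by apply: (wdeg_mulr_inv d0); rewrite mulrC -qE.
by exists (d * d1), p1, q1; split=> //; rewrite -mulrA -?eE -?fE mulrC.
Qed.

(** The resultant lies in the ideal of [p] and [q], so it vanishes at the first coordinate of each
    common zero; by [uniq (map fst s)] these roots are distinct. *)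
Lemma bezout_coprime m k p q (s : seq (F * F)) :
  p != 0 -> q != 0 -> resultant p q != 0 ->
  wdeg m p -> wdeg k q -> uniq (map fst s) ->
  (forall z, z \in s -> p.[z.2%:P].[z.1] = 0 /\ q.[z.2%:P].[z.1] = 0) ->
  (size s <= m * k)%N.
Proof.
move=> p0 q0 r0 wp wq us sz.
have roots (r : {poly F}) N : r != 0 -> (size r <= N.+1)%N ->
    (forall z, z \in s -> r.[z.1] = 0) -> (size s <= N)%N.
  move=> rn0 rN rz; rewrite -(size_map fst) -ltnS (leq_trans _ rN) //.
  apply: max_poly_roots => //; apply/allP => x /mapP[z zs ->].
  by rewrite rootE rz.
case: s us sz roots => // z0 s us sz roots.
(* A nonzero polynomial of total degree 0 has no zero, so a single point of [s] makes [m] and [k]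
   positive. *)
have pos_wdeg N (r : {poly {poly F}}) : r != 0 -> wdeg N r ->
    r.[z0.2%:P].[z0.1] = 0 -> (0 < N)%N.
  move=> + wr; case: N wr => // wr.
  have [c ->] : exists c : F, r = c%:P%:P.
    exists r`_0`_0; rewrite [LHS]size1_polyC ?(wdeg_size wr) //; congr polyC.
    by rewrite [LHS]size1_polyC //; exact: (wr 0%N).
  by rewrite !hornerE !polyC_eq0 => /negP c0 /eqP /c0.
have [zp zq] := sz z0 (mem_head _ _).
have m0 := pos_wdeg m p p0 wp zp; have k0 := pos_wdeg k q q0 wq zq.
(* [resultant_in_ideal] requires both polynomials to involve the outer variable. If one of them does
   not, its own roots are counted. *)
have [p1|p1] := leqP (size p) 1.
  have [c pE] : exists c, p = c%:P by exists p`_0; exact: size1_polyC.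
  apply: (@leq_trans m); last by rewrite leq_pmulr.
  apply: (roots c).
  - by rewrite pE polyC_eq0 in p0.
  - by have := wp 0%N; rewrite pE coefC.
  - by move=> z zs; have [+ _] := sz z zs; rewrite pE !hornerE.
have [q1|q1] := leqP (size q) 1.
  have [c qE] : exists c, q = c%:P by exists q`_0; exact: size1_polyC.
  apply: (@leq_trans k); last by rewrite leq_pmull.
  apply: (roots c).
  - by rewrite qE polyC_eq0 in q0.
  - by have := wq 0%N; rewrite qE coefC.
  - by move=> z zs; have [_] := sz z zs; rewrite qE !hornerE.
apply: (roots (resultant p q)) => //; first exact: size_resultant.
move=> z zs; have [[u v] _ /= uvE] := resultant_in_ideal p1 q1.
have [pz qz] := sz z zs.
have := congr1 (fun r : {poly {poly F}} => r.[z.2%:P].[z.1]) uvE.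
by rewrite !hornerE pz qz !mulr0 addr0.
Qed.

End WeightedDegree.

(** * Shears separating the projections of finitely many points *)

Section Shear.
Variable F : numFieldType.
Implicit Types (f g : {poly F}) (c : F).

Lemma exists_nonroot (p : {poly F}) : p != 0 -> exists x, p.[x] != 0.
Proof.
move=> p0; apply/not_existsP => pz.
have := @max_poly_roots _ p [seq i%:R | i <- iota 0 (size p)] p0.
rewrite size_map size_iota ltnn => abs; apply/notF/abs.
  by apply/allP => x _; rewrite rootE; apply/negPn/negP; exact: pz.
by rewrite map_inj_uniq ?iota_uniq // => i j /eqP; rewrite eqr_nat => /eqP.
Qed.

(** Two distinct points collide only for a slope that is a root of the nonzero polynomial [l z w],
    and the field is infinite. *)
Lemma exists_separating_slope (s : seq (F * F)) : uniq s ->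
  exists c, uniq [seq z.1 + c * z.2 | z <- s].
Proof.
move=> us; pose l (z w : F * F) : {poly F} := (z.1 - w.1)%:P + (z.2 - w.2) *: 'X.
have l0 z w : z != w -> l z w != 0.
  apply: contraNneq => lz; have := congr1 (fun p : {poly F} => p`_0) lz.
  have := congr1 (fun p : {poly F} => p`_1) lz.
  rewrite !coefD !coefZ !coefX !coefC /= mulr0 mulr1 addr0 add0r.
  by case: z w {lz} => [z1 z2] [w1 w2] /= /subr0_eq -> /subr0_eq ->.
have [] := @exists_nonroot (\prod_(z <- s) \prod_(w <- s | w != z) l z w).
  rewrite prodf_seq_neq0; apply/allP => z _ /=; rewrite prodf_seq_neq0.
  by apply/allP => w _ /=; apply/implyP; rewrite eq_sym; exact: l0.
move=> c; rewrite horner_prod prodf_seq_neq0 => /allP cs; exists c.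
rewrite map_inj_in_uniq // => z w zs ws zw; apply/eqP/negPn/negP => nzw.
have := cs z zs; rewrite /= horner_prod prodf_seq_neq0 => /allP /(_ w ws) /implyP.
rewrite eq_sym nzw => /(_ isT) /negP; apply; apply/eqP.
rewrite /l !hornerE /=; move: zw.
move=> /eqP; rewrite -subr_eq0 => /eqP <-.
by rewrite mulrBl opprD addrACA [_ * c]mulrC [w.2 * c]mulrC.
Qed.

(* Substitutes [x = t - c y], with [t] the inner and [y] the outer variable. *)
Definition shear c f : {poly {poly F}} :=
  (map_poly (polyC \o polyC) f).['X%:P - c%:P *: 'X].

Lemma horner_shear c f x y : (shear c f).[y%:P].[x + c * y] = f.[x].
Proof.
elim/poly_ind: f => [|f a IHf]; first by rewrite /shear rmorph0 !horner0.
rewrite /shear rmorphD rmorphM /= map_polyX map_polyC /= hornerD hornerM.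
rewrite -/(shear c f) !hornerD !hornerM hornerX IHf !hornerE.
by rewrite [X in _ * X + _](_ : _ = x) //; ring.
Qed.

Lemma wdeg_leq m k (p : {poly {poly F}}) : (m <= k)%N -> wdeg m p -> wdeg k p.
Proof. by move=> mk wp j; rewrite (leq_trans (wp j)) // leq_sub2r. Qed.

Lemma wdeg_const a : wdeg 0 (a%:P%:P : {poly {poly F}}).
Proof.
move=> j; rewrite coefC; case: j => [|j] /=; last by rewrite size_poly0.
by rewrite size_polyC; case: eqP.
Qed.

Lemma wdeg_shear m c f : (size f <= m.+1)%N -> wdeg m (shear c f).
Proof.
move=> fm; rewrite /shear horner_coef.
have sm : (size (map_poly (polyC \o polyC) f : {poly {poly {poly F}}}) <= m.+1)%N.
  exact: leq_trans (size_poly _ _) fm.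
apply: (big_ind (wdeg m)) => [j|p q|i _]; first by rewrite coef0 size_poly0.
  exact: wdegD.
rewrite coef_map /=.
have w1 : wdeg 1 ('X%:P - c%:P *: 'X : {poly {poly F}}).
  move=> j; rewrite coefB coefC coefZ coefX.
  case: j => [|[|j]] /=; rewrite ?mulr0 ?subr0 ?size_polyX //.
    by rewrite mulr1 sub0r size_polyN size_polyC; case: eqP.
  by rewrite size_poly0.
have wi : wdeg i (('X%:P - c%:P *: 'X) ^+ i : {poly {poly F}}).
  elim: (nat_of_ord i) => [|l IH]; first by rewrite expr0; exact: (wdeg_const 1).
  by rewrite exprS; exact: (wdegM w1 IH).
apply: (@wdeg_leq (0 + i)); first by rewrite add0n -ltnS (leq_trans (ltn_ord i)).
exact: (wdegM (wdeg_const _) wi).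
Qed.

Lemma wdeg_lift m g : (size g <= m.+1)%N -> wdeg m (map_poly polyC g).
Proof.
move=> gm j; rewrite coef_map /=.
have [jm|mj] := leqP j m.
  by rewrite (leq_trans (size_polyC_leq1 _)) // subSn.
by rewrite nth_default ?size_poly0 // (leq_trans gm).
Qed.

Lemma horner_lift g x y : (map_poly polyC g).[y%:P].[x] = g.[y].
Proof. by rewrite horner_map /= hornerC. Qed.

(** The contrapositive of Bezout's bound: too many common zeros leave one of them on a common factor
    [d]. The factorizations are given as identities of values in the original coordinates, so the
    shear is not visible afterwards except through [c]. *)
Lemma bezout_separated m k f1 g1 f2 g2 (s : seq (F * F)) :
  (size f1 <= m.+1)%N -> (size g1 <= m.+1)%N ->
  (size f2 <= k.+1)%N -> (size g2 <= k.+1)%N ->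
  (exists z, f1.[z.1] != g1.[z.2]) ->
  uniq s -> (forall z, z \in s -> f1.[z.1] = g1.[z.2] /\ f2.[z.1] = g2.[z.2]) ->
  (m * k < size s)%N ->
  exists c (d p q : {poly {poly F}}) z, let ev r x y := r.[y%:P].[x + c * y] in
  [/\ z \in s, ev d z.1 z.2 = 0,
      forall x y, f1.[x] - g1.[y] = ev d x y * ev p x y &
      forall x y, f2.[x] - g2.[y] = ev d x y * ev q x y].
Proof.
move=> sf1 sg1 sf2 sg2 [z0 nz0] us sz szs.
have [c uc] := exists_separating_slope us.
pose P := shear c f1 - map_poly polyC g1.
pose Q := shear c f2 - map_poly polyC g2.
have evP x y : P.[y%:P].[x + c * y] = f1.[x] - g1.[y].
  by rewrite /P !hornerD !hornerN horner_shear horner_lift.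
have evQ x y : Q.[y%:P].[x + c * y] = f2.[x] - g2.[y].
  by rewrite /Q !hornerD !hornerN horner_shear horner_lift.
have wdegB i (p q : {poly {poly F}}) : wdeg i p -> wdeg i q -> wdeg i (p - q).
  by move=> wp wq; apply: wdegD => // j; rewrite coefN size_polyN.
have wP : wdeg m P by apply: wdegB; [exact: wdeg_shear | exact: wdeg_lift].
have wQ : wdeg k Q by apply: wdegB; [exact: wdeg_shear | exact: wdeg_lift].
have P0 : P != 0.
  apply: contraNneq nz0 => P0; rewrite -subr_eq0 -evP P0.
  by rewrite !hornerE.
have [Q0|Q0] := eqVneq Q 0.
  (* When [Q] vanishes identically the common factor is [P] itself, and any point of [s] serves. *)
  case: s szs us sz uc => // z s _ _ sz _.
  exists c, P, 1, 0, z => ev; split=> [||x y|x y].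
  - exact: mem_head.
  - by rewrite /ev evP; have [-> _] := sz z (mem_head _ _); rewrite subrr.
  - by rewrite /ev evP !hornerE.
  - by rewrite /ev -evQ Q0 !hornerE.
have [d [p [q [PE QE wp wq r0]]]] := coprime_cofactors P0 Q0 wP wQ.
have p0 : p != 0 by apply: contraNneq P0; rewrite PE => ->; rewrite mulr0.
have q0 : q != 0 by apply: contraNneq Q0; rewrite QE => ->; rewrite mulr0.
have [|/allPn[z zs dz]] := boolP (all (fun z => d.[z.2%:P].[z.1 + c * z.2] != 0) s);
  last first.
  exists c, d, p, q, z => ev; split => //; first by apply/eqP/negPn.
    by move=> x y; rewrite /ev -evP PE !hornerE.
  by move=> x y; rewrite /ev -evQ QE !hornerE.
(* If [d] vanishes at no point of [s], all of them are common zeros of the coprime cofactors, whose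
   total degrees are still at most [m] and [k]. *)
move=> /allP ds; move: szs; rewrite ltnNge => /negP[].
have := @bezout_coprime _ m k p q [seq (z.1 + c * z.2, z.2) | z <- s] p0 q0 r0 wp wq.
rewrite size_map -map_comp; apply; first exact: uc.
move=> _ /mapP[z zs ->] /=; have [fz gz] := sz z zs.
have := evP z.1 z.2; have := evQ z.1 z.2.
rewrite fz gz !subrr PE QE !hornerE => /eqP; rewrite mulf_eq0 (negPf (ds _ zs)) /=.
move=> /eqP q00 /eqP; rewrite mulf_eq0 (negPf (ds _ zs)) /= => /eqP p00.
by split.
Qed.

End Shear.

Local Open Scope classical_set_scope.

(** * Common factors give non-isolated solutions *)

Section Local.
Variable R : realType.

Lemma poly_eqfun (p q : {poly R}) : (forall x, p.[x] = q.[x]) -> p = q.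
Proof.
move=> pq; apply/eqP; rewrite -subr_eq0; apply/negPn/negP => /exists_nonroot[x].
by rewrite hornerD hornerN pq subrr eqxx.
Qed.

Lemma continuous_horner2 (r : {poly {poly R}}) (c : R) :
  continuous (fun u : R * R => r.[u.2%:P].[u.1 + c * u.2]).
Proof.
elim/poly_ind: r => [|r a IHr] u.
  rewrite (_ : (fun _ => _) = (fun=> 0)); first exact: cvg_cst.
  by apply/funext => v; rewrite !horner0.
rewrite (_ : (fun _ => _) = (fun u : R * R =>
    r.[u.2%:P].[u.1 + c * u.2] * u.2 + a.[u.1 + c * u.2])); last first.
  by apply/funext => v; rewrite !hornerE.
apply: cvgD; first by apply: cvgM; [exact: IHr | exact: cvg_snd].
apply: (@continuous_comp _ _ _ (fun u : R * R => u.1 + c * u.2) (horner a)).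
  apply: cvgD; first exact: cvg_fst.
  by apply: cvgM; [exact: cvg_cst | exact: cvg_snd].
exact: continuous_horner.
Qed.

Lemma nonzero_nearby (h : R -> R) (x : R) : {for x, continuous h} -> h x != 0 ->
  exists2 e, 0 < e & forall t, `|t - x| < e -> 0 < h t * h x.
Proof.
move=> ch h0.
have : \forall t \near x, 0 < h t * h x.
  have := @cvgr_gt _ _ (nbhs x) _ (fun t => h t * h x) (h x * h x).
  apply; last by rewrite -expr2 lt_neqAle sqr_ge0 eq_sym sqrf_eq0 h0.
  by apply: cvgM; [exact: ch | exact: cvg_cst].
move=> /nbhs_ballP[e e0 he]; exists e => // t xt; apply: he.
by rewrite /ball /= distrC.
Qed.

Lemma poly_sign_change (f : {poly R}) (x e : R) : 0 < e -> f^`().[x] != 0 ->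
  exists a b, [/\ x - e < a, a <= b, b < x + e &
    (f.[a] - f.[x]) * (f.[b] - f.[x]) < 0].
Proof.
move=> e0 f'x.
have [h hE] : exists h, f - f.[x]%:P = h * ('X - x%:P).
  by apply/factor_theorem; rewrite rootE !hornerE subrr.
have hx : h.[x] = f^`().[x].
  have := congr1 (fun p : {poly R} => p^`().[x]) hE.
  by rewrite derivB derivC subr0 => ->; rewrite derivM derivXsubC !hornerE /=; ring.
have hx0 : h.[x] != 0 by rewrite hx.
have [e1 e10 he1] := nonzero_nearby (@continuous_horner _ h x) hx0.
pose m := Num.min e e1 / 2.
have m0 : 0 < m by rewrite divr_gt0 // lt_min e0.
have me : m < e /\ m < e1.
  by rewrite /m; split; rewrite ltr_pdivrMr // minElt; case: ifP; lra.
have hb y : f.[y] - f.[x] = h.[y] * (y - x).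
  by have := congr1 (horner^~ y) hE; rewrite !hornerE.
exists (x - m), (x + m); split; try lra.
rewrite !hb.
have h1 : 0 < h.[x - m] * h.[x] by apply: he1; rewrite (_ : _ - _ = - m) ?normrN ?gtr0_norm //; lra.
have h2 : 0 < h.[x + m] * h.[x] by apply: he1; rewrite (_ : _ - _ = m) ?gtr0_norm //; lra.
have h3 : 0 < h.[x - m] * h.[x + m].
  have : 0 < (h.[x - m] * h.[x]) * (h.[x + m] * h.[x]) by exact: mulr_gt0.
  rewrite mulrACA pmulr_lgt0 // -expr2 lt_neqAle sqr_ge0 andbT eq_sym sqrf_eq0.
  by rewrite hx.
have [-> ->] : x - m - x = - m /\ x + m - x = m by split; ring.
by rewrite mulrACA pmulr_rlt0 // mulNr oppr_lt0 mulr_gt0.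
Qed.

(** The intermediate value theorem in [x], at one height close to [y0], replaces the implicit
    function theorem: it finds a zero of the first polynomial where [p] is nonzero, hence a zero of
    [d]. *)
Lemma common_factor_not_isolated (f1 g1 f2 g2 : {poly R}) c
    (d p q : {poly {poly R}}) (x0 y0 : R) :
  let ev r x y := r.[y%:P].[x + c * y] in
  (forall x y, f1.[x] - g1.[y] = ev d x y * ev p x y) ->
  (forall x y, f2.[x] - g2.[y] = ev d x y * ev q x y) ->
  ev d x0 y0 = 0 -> f1^`().[x0] != 0 ->
  forall e : R, 0 < e -> exists x y,
    [/\ y != y0, `|x - x0| < e, `|y - y0| < e, f1.[x] = g1.[y] & f2.[x] = g2.[y]].
Proof.
move=> ev E1 E2 d0 f1' e e0.
have f1x0 : f1.[x0] = g1.[y0] by apply/subr0_eq; rewrite E1 d0 mul0r.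
have p0 : ev p x0 y0 != 0.
  (* If [d] and [p] both vanished at the point, the product rule on the line of height [y0] would
     make the derivative of [f1] vanish. *)
  apply: contraNneq f1' => p0.
  pose sl (r : {poly {poly R}}) := r.[y0%:P] \Po ('X + (c * y0)%:P).
  have slE r x : (sl r).[x] = ev r x y0 by rewrite /sl horner_comp !hornerE.
  have : f1 - g1.[y0]%:P = sl d * sl p.
    by apply: poly_eqfun => x; rewrite hornerM !slE -E1 !hornerE.
  move=> /(congr1 (fun p : {poly R} => p^`().[x0])).
  rewrite derivB derivC subr0 => ->; rewrite derivM !hornerE /=.
  by rewrite !slE d0 p0; apply/eqP; ring.
have cp : (fun u : R * R => ev p u.1 u.2 * ev p x0 y0) @ nbhs (x0, y0) -->
    ev p x0 y0 * ev p x0 y0.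
  by apply: cvgM; [exact: (@continuous_horner2 p c (x0, y0)) | exact: cvg_cst].
have : \forall u \near (x0, y0), 0 < ev p u.1 u.2 * ev p x0 y0.
  apply: (cvgr_gt _ cp).
  by rewrite -expr2 lt_neqAle sqr_ge0 eq_sym sqrf_eq0 p0.
move=> /nbhs_ballP[e1 /= e10 he1].
pose m := Num.min e e1.
have m0 : 0 < m by rewrite lt_min e0.
have [me me1] : m <= e /\ m <= e1 by rewrite /m !ge_min !lexx orbT.
have [a [b [xa ab bx fab]]] := poly_sign_change m0 f1'.
have : \forall y \near y0, (f1.[a] - g1.[y]) * (f1.[b] - g1.[y]) < 0.
  have := @cvgr_lt _ _ (nbhs y0) _
    (fun y => (f1.[a] - g1.[y]) * (f1.[b] - g1.[y]))
    ((f1.[a] - g1.[y0]) * (f1.[b] - g1.[y0])).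
  apply; last by rewrite -f1x0.
  by apply: cvgM; apply: cvgB; [exact: cvg_cst | exact: continuous_horner |
     exact: cvg_cst | exact: continuous_horner].
move=> /nbhs_ballP[e2 /= e20 he2].
(* Any close height other than [y0] would do: the sign change between [a] and [b] persists there. *)
pose y := y0 + Num.min m e2 / 2.
have mm0 : 0 < Num.min m e2 by rewrite lt_min m0.
have [mm1 mm2] : Num.min m e2 <= m /\ Num.min m e2 <= e2.
  by split; rewrite ge_min lexx ?orbT.
have yy0 : `|y - y0| = Num.min m e2 / 2.
  by rewrite /y addrAC subrr add0r gtr0_norm // divr_gt0.
have fy : (f1.[a] - g1.[y]) * (f1.[b] - g1.[y]) < 0.
  by apply: he2; rewrite /ball /= distrC yy0; lra.
have [||x] := @IVT R (horner f1) a b g1.[y] ab.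
- by apply: continuous_subspaceT; exact: continuous_horner.
- rewrite ge_min le_max; apply/andP; split; apply/orP.
    have [|h1] := leP f1.[a] g1.[y]; [by left | right].
    rewrite leNgt; apply/negP => h2; move: fy.
    by rewrite ltNge mulr_ge0 // subr_ge0 ltW.
  have [|h1] := leP g1.[y] f1.[a]; [by left | right].
  rewrite leNgt; apply/negP => h2; move: fy.
  by rewrite ltNge -mulrNN mulr_ge0 // opprB subr_ge0 ltW.
rewrite in_itv /= => /andP[ax xb] fx.
have xx0 : `|x - x0| < m by rewrite ltr_norml; apply/andP; split; lra.
exists x, y; split => //; try lra.
- by rewrite -subr_eq0 -normr_gt0 yy0; lra.
- have px : ev p x y != 0.
    have : 0 < ev p x y * ev p x0 y0.
      by apply: (he1 (x, y)); split; rewrite /ball /= distrC ?yy0; lra.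
    by case: eqVneq => // ->; rewrite mul0r ltxx.
  have : ev d x y * ev p x y == 0 by rewrite -E1 fx subrr.
  rewrite mulf_eq0 (negPf px) orbF => /eqP dz.
  by apply/subr0_eq; rewrite E2 dz mul0r.
Qed.

End Local.

(** * The Picard-Lindelof theorem *)

Section Calculus.
Variable R : realType.

Lemma antiderivative (f : R -> R) : continuous f -> exists F : R -> R,
  [/\ continuous F, forall t : R, t <= 0 -> F t = 0 &
      forall t : R, 0 < t -> is_derive t 1 F (f t)].
Proof.
move=> cf; pose mu := @lebesgue_measure R.
(* Starting the integral at -1 makes [G] differentiable at 0, hence continuous there; composing with
   [Num.max t 0] then freezes the primitive at negative times. *)
pose G (x : R) := (\int[mu]_(t in [set` `[(-1 : R), x]]) (f t))%R.
have dG (x : R) : -1 < x -> is_derive x 1 G (f x).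
  move=> x1; have [] := @continuous_FTC1_closed R f (-1) x (x + 1) _ _ x1 (cf x).
  - by rewrite ltrDl.
  - apply: continuous_compact_integrable; first exact: segment_compact.
    exact: continuous_subspaceT.
  by move=> dG <-; rewrite derive1E; exact: derivableP.
exists (fun t : R => G (Num.max t 0) - G 0); split.
- move=> t; apply: cvgB; last exact: cvg_cst.
  apply: (@continuous_comp _ _ _ (fun t : R => Num.max t 0) G).
    by apply: continuous_max; [exact: cvg_id | exact: cvg_cst].
  have /dG h : -1 < Num.max t 0 by rewrite lt_max ltrN10 orbT.
  by apply: differentiable_continuous; apply/derivable1_diffP; exact: ex_derive.
- by move=> t t0; rewrite max_r // subrr.
- move=> t t0; apply: (@near_eq_is_derive _ _ _ (fun t : R => G t - G 0)).
  + near=> s; rewrite max_l //; apply: ltW; near: s; exact: lt_nbhsr.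
  + have := dG t (lt_trans (ltrN10 R) t0) => dGt.
    by rewrite -[f t]subr0; exact: is_deriveB.
Unshelve. all: by end_near. Qed.

Lemma derive_comparison (u v du dv : R -> R) (a b : R) : a <= b ->
  {within `[a, b], continuous u} -> {within `[a, b], continuous v} ->
  (forall t : R, a < t < b -> is_derive t 1 u (du t)) ->
  (forall t : R, a < t < b -> is_derive t 1 v (dv t)) ->
  (forall t : R, a < t < b -> du t <= dv t) ->
  u b - u a <= v b - v a.
Proof.
move=> ab cu cv du' dv' duv.
move: ab; rewrite le_eqVlt => /predU1P[->|ab]; first by rewrite !subrr.
have [||t tab E] := @MVT R (v \- u) (dv \- du) a b ab.
- move=> t; rewrite in_itv /= => tab.
  by have h1 := du' t tab; have h2 := dv' t tab; exact: is_deriveB.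
- by move=> t; apply: cvgB; [exact: cv | exact: cu].
have : 0 <= (dv \- du) t * (b - a).
  by rewrite mulr_ge0 ?subr_ge0 ?(ltW ab) //; apply: duv; move: tab; rewrite in_itv.
rewrite -E /=; lra.
Qed.

Lemma derive_comparison_abs (u v du dv : R -> R) (a b : R) : a <= b ->
  {within `[a, b], continuous u} -> {within `[a, b], continuous v} ->
  (forall t : R, a < t < b -> is_derive t 1 u (du t)) ->
  (forall t : R, a < t < b -> is_derive t 1 v (dv t)) ->
  (forall t : R, a < t < b -> `|du t| <= dv t) ->
  `|u b - u a| <= v b - v a.
Proof.
move=> ab cu cv du' dv' duv; rewrite ler_norml; apply/andP; split; last first.
  apply: (derive_comparison ab cu cv du' dv') => t /duv.
  by apply: le_trans; exact: ler_norm.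
have cNu : {within `[a, b], continuous (\- u)}.
  by move=> t; apply: cvgN; exact: cu.
have := @derive_comparison (\- u) v (\- du) dv a b ab cNu cv _ dv' _.
rewrite /= => h; rewrite lerNl.
have -> : - (u b - u a) = - u b - - u a by ring.
apply: h => t tab; first by have := du' t tab => ?; exact: is_deriveN.
by apply: le_trans (duv t tab); rewrite -normrN; exact: ler_norm.
Qed.

Lemma is_derive_expM (k t : R) :
  is_derive t 1 (fun s => expR (k * s)) (k * expR (k * t)).
Proof.
have hk : is_derive t 1 (fun s : R => k * s) k.
  have := @is_deriveZ R R R id k t 1 1 _.
  by rewrite /GRing.scale /= mulr1; apply.
have := @is_derive1_comp R expR (fun s => k * s) t _ _ (is_derive_expR _) hk.
by rewrite mulrC.
Qed.

Lemma derivable_within_continuous_itv (u : R -> R) (du : R -> R) (a b : R) :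
  (forall t : R, is_derive t 1 u (du t)) -> {within `[a, b], continuous u}.
Proof.
move=> du'; apply: continuous_subspaceT => t.
apply: differentiable_continuous; apply/derivable1_diffP.
by have := du' t => ?; exact: ex_derive.
Qed.

Lemma gronwall (E dE : R -> R) (k b : R) : 0 <= b ->
  {within `[0, b], continuous E} ->
  (forall t : R, 0 < t < b -> is_derive t 1 E (dE t)) ->
  (forall t : R, 0 < t < b -> dE t <= k * E t) ->
  E b <= E 0 * expR (k * b).
Proof.
move=> b0 cE dE' kE.
(* Integrating factor: the assumption on [dE] makes the derivative of [w] nonpositive. *)
pose w t := E t * expR ((- k) * t).
have cexp : {within `[0, b], continuous (fun s : R => expR ((- k) * s))}.
  apply: (@derivable_within_continuous_itv _ (fun t => - k * expR (- k * t))).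
  by move=> t; exact: is_derive_expM.
have := @derive_comparison w (fun=> 0)
  (fun t => E t * (- k * expR (- k * t)) + expR (- k * t) * dE t) (fun=> 0) 0 b b0.
rewrite /w subrr mulr0 expR0 mulr1 => H.
have : E b * expR (- k * b) - E 0 <= 0.
  apply: H.
  - by move=> t; apply: cvgM; [exact: cE | exact: cexp].
  - by apply: continuous_subspaceT => t; exact: cvg_cst.
  - move=> t tb; have h1 := dE' t tb; have h2 := is_derive_expM (- k) t.
    exact: is_deriveM.
  - move=> t tb; rewrite [leLHS](_ : _ = expR (- k * t) * (dE t - k * E t)).
      by rewrite pmulr_rle0 ?expR_gt0 // subr_le0 kE.
    by ring.
rewrite subr_le0 mulNr expRN ler_pdivrMr ?expR_gt0 //.
Qed.
End Calculus.

(** * Continuous dependence and Picard iteration for a bounded Lipschitz field *)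

Section PicardLindelof.
Variable R : realType.

Lemma div_exp2_small (C e : R) : 0 <= C -> 0 < e -> exists n, C / 2 ^+ n < e.
Proof.
move=> C0 e0; exists (Num.bound (C / e)).
have : C / e < (Num.bound (C / e))%:R by rewrite archi_boundP // divr_ge0 // ltW.
set n := Num.bound _ => h.
rewrite ltr_pdivrMr ?exprn_gt0 // mulrC -ltr_pdivrMr // (lt_trans h) //.
by rewrite -natrX ltr_nat ltn_expl.
Qed.

(** The radius [2 * C / 2 ^+ n] is the sum of all remaining steps, so the intervals around [a n] are
    nested, and the supremum of their lower ends lies in each. *)
Lemma geometric_limit (a : nat -> R) (C : R) :
  (forall n, `|a n.+1 - a n| <= C / 2 ^+ n) ->
  exists l, forall n, `|l - a n| <= 2 * C / 2 ^+ n.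
Proof.
move=> aC; pose b n := a n - 2 * C / 2 ^+ n; pose c n := a n + 2 * C / 2 ^+ n.
have e2 n : 2 * C / 2 ^+ n.+1 = C / 2 ^+ n.
  by rewrite exprS invfM mulrACA divff ?mul1r.
have e2' n : 2 * C / 2 ^+ n = C / 2 ^+ n + C / 2 ^+ n by ring.
have bS n : b n <= b n.+1.
  by rewrite /b e2 e2'; have := aC n; rewrite ler_norml; lra.
have cS n : c n.+1 <= c n.
  by rewrite /c e2 e2'; have := aC n; rewrite ler_norml; lra.
have C0 n : 0 <= C / 2 ^+ n by exact: le_trans (aC n).
have bc n : b n <= c n by rewrite /b /c e2'; have := C0 n; lra.
have bm : {homo b : i j / (i <= j)%N >-> i <= j} by apply/nondecreasing_seqP.
have cm : {homo c : i j / (i <= j)%N >-> j <= i}.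
  by apply/nonincreasing_seqP.
have bcm n m : b n <= c m.
  by rewrite (le_trans (bm _ _ (leq_maxl n m))) // (le_trans (bc _)) // cm // leq_maxr.
have supb : has_sup (range b).
  by split; [exists (b 0%N); exists 0%N | exists (c 0%N) => _ [n _ <-]].
exists (sup (range b)) => n.
have h1 : b n <= sup (range b) by apply: sup_upper_bound => //; exists n.
have h2 : sup (range b) <= c n.
  by apply: ge_sup => [|_ [m _ <-]]; first by case: supb.
by move: h1 h2; rewrite /b /c ler_norml; lra.
Qed.

Variables (g1 g2 : R * R -> R) (L M : R).
Hypothesis L1 : 1 <= L.
Hypothesis g1L : forall u v, `|g1 u - g1 v| <= L * (`|u.1 - v.1| + `|u.2 - v.2|).
Hypothesis g2L : forall u v, `|g2 u - g2 v| <= L * (`|u.1 - v.1| + `|u.2 - v.2|).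
Hypothesis g1M : forall u, `|g1 u| <= M.
Hypothesis g2M : forall u, `|g2 u| <= M.

(** Derivatives are required only inside the interval, as for trajectory arcs, which need not be
    differentiable at their ends. *)
Definition solves (y : R -> R * R) (b : R) :=
  [/\ {within `[0, b], continuous (fst \o y)},
      {within `[0, b], continuous (snd \o y)},
      forall t : R, 0 < t < b -> is_derive t 1 (fst \o y) (g1 (y t)) &
      forall t : R, 0 < t < b -> is_derive t 1 (snd \o y) (g2 (y t))].

(** Gronwall's inequality is applied to the squared Euclidean distance, which is differentiable. The
    rate [4 * L] comes from bounding its derivative by 2 L (|d1| + |d2|)^2, which is at most 4 L
    (d1^2 + d2^2). *)
Lemma solves_dependence (y z : R -> R * R) (b : R) : 0 <= b ->
  solves y b -> solves z b ->
  ((y b).1 - (z b).1) ^+ 2 + ((y b).2 - (z b).2) ^+ 2 <=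
  (((y 0).1 - (z 0).1) ^+ 2 + ((y 0).2 - (z 0).2) ^+ 2) * expR (4 * L * b).
Proof.
move=> b0 [cy1 cy2 dy1 dy2] [cz1 cz2 dz1 dz2].
apply: (@gronwall _
  (fun t => ((y t).1 - (z t).1) ^+ 2 + ((y t).2 - (z t).2) ^+ 2)
  (fun t => 2 * ((y t).1 - (z t).1) * (g1 (y t) - g1 (z t)) +
            2 * ((y t).2 - (z t).2) * (g2 (y t) - g2 (z t)))) => //.
- move=> t; apply: cvgD.
    by rewrite expr2; apply: cvgM; apply: cvgB; [exact: cy1|exact: cz1|exact: cy1|exact: cz1].
  by rewrite expr2; apply: cvgM; apply: cvgB; [exact: cy2|exact: cz2|exact: cy2|exact: cz2].
- move=> t tb; have h1 := dy1 t tb; have h2 := dy2 t tb.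
  have h3 := dz1 t tb; have h4 := dz2 t tb.
  apply: is_derive_eq (_ : is_derive t 1 ((((fst \o y) \- (fst \o z)) ^+ 2) \+
     (((snd \o y) \- (snd \o z)) ^+ 2)) _) _.
  by rewrite /GRing.scale /=; ring.
- move=> t _; set d1 := _ - _; set d2 := (y t).2 - _.
  have q1 := g1L (y t) (z t); have q2 := g2L (y t) (z t).
  rewrite -/d1 -/d2 in q1 q2.
  have r1 : d1 * (g1 (y t) - g1 (z t)) <= `|d1| * (L * (`|d1| + `|d2|)).
    by rewrite (le_trans (ler_norm _)) // normrM ler_wpM2l.
  have r2 : d2 * (g2 (y t) - g2 (z t)) <= `|d2| * (L * (`|d1| + `|d2|)).
    by rewrite (le_trans (ler_norm _)) // normrM ler_wpM2l.
  have : L * (`|d1| - `|d2|) ^+ 2 >= 0 by rewrite mulr_ge0 ?sqr_ge0 // (le_trans _ L1).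
  have n1 : `|d1| ^+ 2 = d1 ^+ 2 by rewrite real_normK ?num_real.
  have n2 : `|d2| ^+ 2 = d2 ^+ 2 by rewrite real_normK ?num_real.
  rewrite -n1 -n2; nra.
Qed.

(* Junk value [f] when [f] is not continuous. *)
Definition antider (f : R -> R) : R -> R :=
  if pselect (continuous f) is left cf then projT1 (cid (antiderivative cf)) else f.

Lemma antiderP (f : R -> R) : continuous f ->
  [/\ continuous (antider f), forall t : R, t <= 0 -> antider f t = 0 &
      forall t : R, 0 < t -> is_derive t 1 (antider f) (f t)].
Proof. by move=> cf; rewrite /antider; case: pselect => // cf'; case: cid. Qed.

Lemma lipschitz_comp_continuous (g : R * R -> R) (y1 y2 : R -> R) :
  (forall u v, `|g u - g v| <= L * (`|u.1 - v.1| + `|u.2 - v.2|)) ->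
  continuous y1 -> continuous y2 -> continuous (fun t => g (y1 t, y2 t)).
Proof.
move=> gL c1 c2 t; have L0 : 0 < L by exact: lt_le_trans L1.
apply/cvgrPdist_lt => e e0; near=> s.
rewrite (le_lt_trans (gL _ _)) //= mulrC -ltr_pdivlMr //.
have h1 : `|y1 t - y1 s| < e / L / 2.
  near: s; apply: cvgr_dist_lt; first exact: c1.
  by rewrite !divr_gt0.
have h2 : `|y2 t - y2 s| < e / L / 2.
  near: s; apply: cvgr_dist_lt; first exact: c2.
  by rewrite !divr_gt0.
lra.
Unshelve. all: by end_near. Qed.

Variable u0 : R * R.

(** The iterates are defined on the whole line and rest at [u0] for negative times, so no interval
    of existence has to be chosen. *)
Definition picard_step (y : R -> R * R) (t : R) : R * R :=
  (u0.1 + antider (g1 \o y) t, u0.2 + antider (g2 \o y) t).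

Arguments picard_step : simpl never.

Definition picard n := iter n picard_step (fun=> u0).

Definition pcontinuous (y : R -> R * R) :=
  continuous (fst \o y) /\ continuous (snd \o y).

Lemma pcontinuous_comp (g : R * R -> R) (y : R -> R * R) :
  (forall u v, `|g u - g v| <= L * (`|u.1 - v.1| + `|u.2 - v.2|)) ->
  pcontinuous y -> continuous (g \o y).
Proof.
move=> gL [c1 c2].
rewrite (_ : g \o y = fun t => g ((fst \o y) t, (snd \o y) t)).
  exact: lipschitz_comp_continuous.
by apply/funext => t /=; case: (y t).
Qed.

Lemma picard_stepP (y : R -> R * R) : pcontinuous y ->
  [/\ pcontinuous (picard_step y), forall t : R, t <= 0 -> picard_step y t = u0,
    forall t : R, 0 < t -> is_derive t 1 (fst \o picard_step y) (g1 (y t)) &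
    forall t : R, 0 < t -> is_derive t 1 (snd \o picard_step y) (g2 (y t))].
Proof.
move=> cy; have [cA1 A10 dA1] := antiderP (pcontinuous_comp g1L cy).
have [cA2 A20 dA2] := antiderP (pcontinuous_comp g2L cy).
split.
- by split=> t; apply: cvgD; [exact: cvg_cst | exact: cA1 | exact: cvg_cst | exact: cA2].
- by move=> t t0; rewrite /picard_step A10 // A20 // !addr0 -surjective_pairing.
- move=> t t0; have h := dA1 t t0; rewrite -[g1 _]add0r.
  exact: (@is_deriveD _ _ _ (cst u0.1) (antider (g1 \o y))).
- move=> t t0; have h := dA2 t t0; rewrite -[g2 _]add0r.
  exact: (@is_deriveD _ _ _ (cst u0.2) (antider (g2 \o y))).
Qed.

Lemma picard_continuous n : pcontinuous (picard n).
Proof.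
elim: n => [|n IH]; first by split=> t; exact: cvg_cst.
by have [] := picard_stepP IH.
Qed.

(* The weight [exp(4 L t)] makes the Picard map a contraction of ratio 1/2. *)
Lemma picard_step_close (y z : R -> R * R) (D t : R) : 0 <= D -> pcontinuous y -> pcontinuous z ->
  (forall s : R, 0 < s -> `|(y s).1 - (z s).1| <= 2 * D * expR (4 * L * s)) ->
  (forall s : R, 0 < s -> `|(y s).2 - (z s).2| <= 2 * D * expR (4 * L * s)) ->
  `|(picard_step y t).1 - (picard_step z t).1| <= D * expR (4 * L * t) /\
  `|(picard_step y t).2 - (picard_step z t).2| <= D * expR (4 * L * t).
Proof.
move=> D0 cy cz yz1 yz2.
have [[cy1 cy2] y0 dy1 dy2] := picard_stepP cy.
have [[cz1 cz2] z0 dz1 dz2] := picard_stepP cz.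
have [t0|t0] := leP t 0.
  by rewrite y0 // z0 // !subrr normr0 mulr_ge0 // expR_ge0.
have L0 : 0 < L by exact: lt_le_trans L1.
have key (p : R * R -> R) (g : R * R -> R) : 
    (forall u v, `|g u - g v| <= L * (`|u.1 - v.1| + `|u.2 - v.2|)) ->
    continuous (p \o picard_step y) -> continuous (p \o picard_step z) ->
    (forall t : R, 0 < t -> is_derive t 1 (p \o picard_step y) (g (y t))) ->
    (forall t : R, 0 < t -> is_derive t 1 (p \o picard_step z) (g (z t))) ->
    `|p (picard_step y t) - p (picard_step z t)| <= D * expR (4 * L * t).
  move=> gL cpy cpz dpy dpz.
  have := @derive_comparison_abs _ ((p \o picard_step y) \- (p \o picard_step z))
    (fun s => D * expR (4 * L * s)) (fun s => g (y s) - g (z s))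
    (fun s => D * (4 * L * expR (4 * L * s))) 0 t (ltW t0).
  rewrite /= (y0 0) // (z0 0) // subrr subr0 mulr0 expR0 mulr1 => H.
  apply: (@le_trans _ _ (D * expR (4 * L * t) - D)); last by rewrite gerBl.
  apply: H.
  - by apply: continuous_subspaceT => s; apply: cvgB; [exact: cpy|exact: cpz].
  - apply: (@derivable_within_continuous_itv _ _ (fun s => D * (4 * L * expR (4 * L * s)))).
    by move=> s; have := is_derive_expM (4 * L) s => ?; exact: is_deriveZ.
  - move=> s /andP[s0 _]; have h1 := dpy s s0; have h2 := dpz s s0.
    exact: is_deriveB.
  - by move=> s _; have := is_derive_expM (4 * L) s => ?; exact: is_deriveZ.
  - move=> s /andP[s0 _]; rewrite (le_trans (gL _ _)) //.
    rewrite (_ : D * _ = L * (2 * D * expR (4 * L * s) + 2 * D * expR (4 * L * s))); last by ring.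
    by rewrite ler_pM2l // lerD // ?yz1 ?yz2.
by split; [exact: (key fst g1) | exact: (key snd g2)].
Qed.

Lemma picard_cauchy n (t : R) :
  `|(picard n.+1 t).1 - (picard n t).1| <= M / 2 ^+ n * expR (4 * L * t) /\
  `|(picard n.+1 t).2 - (picard n t).2| <= M / 2 ^+ n * expR (4 * L * t).
Proof.
have M0 : 0 <= M by exact: le_trans (g1M u0).
have L0 : 0 < L by exact: lt_le_trans L1.
elim: n t => [|n IH] t; last first.
  apply: (picard_step_close (y := picard n.+1) (z := picard n) (D := M / 2 ^+ n.+1)).
  - by rewrite divr_ge0 // exprn_ge0.
  - exact: picard_continuous.
  - exact: picard_continuous.
  - move=> s _; rewrite exprS invfM [2 * _](_ : _ = M / 2 ^+ n); last by field.
    by have [] := IH s.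
  - move=> s _; rewrite exprS invfM [2 * _](_ : _ = M / 2 ^+ n); last by field.
    by have [] := IH s.
rewrite expr0 divr1.
have [[c1 c2] y0 d1 d2] := picard_stepP (picard_continuous 0).
rewrite [picard 1](_ : _ = picard_step (picard 0)) // -/(picard 0).
have [t0|t0] := leP t 0.
  by rewrite y0 // !subrr normr0 mulr_ge0 // expR_ge0.
have key (p : R * R -> R) (g : R * R -> R) : (forall u, `|g u| <= M) ->
    continuous (p \o picard_step (picard 0)) ->
    (forall t : R, 0 < t -> is_derive t 1 (p \o picard_step (picard 0)) (g (picard 0 t))) ->
    `|p (picard_step (picard 0) t) - p u0| <= M * expR (4 * L * t).
  move=> gM cp dp.
  have := @derive_comparison_abs _ (p \o picard_step (picard 0))
    (fun s => M * expR (4 * L * s)) (fun s => g u0)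
    (fun s => M * (4 * L * expR (4 * L * s))) 0 t (ltW t0).
  rewrite /= (y0 0) // mulr0 expR0 mulr1 => H.
  apply: (@le_trans _ _ (M * expR (4 * L * t) - M)); last by rewrite gerBl.
  apply: H.
  - exact: continuous_subspaceT.
  - apply: (@derivable_within_continuous_itv _ _ (fun s => M * (4 * L * expR (4 * L * s)))).
    by move=> s; have := is_derive_expM (4 * L) s => ?; exact: is_deriveZ.
  - by move=> s /andP[s0 _]; exact: dp.
  - by move=> s _; have := is_derive_expM (4 * L) s => ?; exact: is_deriveZ.
  - move=> s /andP[s0 _]; rewrite (le_trans (gM _)) // ler_peMr //.
    (* The normalization [1 <= L] enters here: the weight has slope at least 1, so [M] times the
       weight dominates the first step. *)
    have : 1 <= expR (4 * L * s) by rewrite -expR0 ler_expR !mulr_ge0 // ltW.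
    move=> /(mulr_ege1 L1); rewrite -mulrA; lra.
by split; [exact: (key fst g1) | exact: (key snd g2)].
Qed.

Lemma picard_lindelof : exists y : R -> R * R,
  [/\ pcontinuous y, y 0 = u0 & forall b, solves y b].
Proof.
have M0 : 0 <= M by exact: le_trans (g1M u0).
have L0 : 0 < L by exact: lt_le_trans L1.
have lim (t : R) : exists l : R * R, forall n,
    `|l.1 - (picard n t).1| <= 2 * (M / 2 ^+ n) * expR (4 * L * t) /\
    `|l.2 - (picard n t).2| <= 2 * (M / 2 ^+ n) * expR (4 * L * t).
  have [n|l1 l1P] := @geometric_limit (fun n => (picard n t).1) (M * expR (4 * L * t)).
    by have [+ _] := picard_cauchy n t; rewrite mulrAC.
  have [n|l2 l2P] := @geometric_limit (fun n => (picard n t).2) (M * expR (4 * L * t)).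
    by have [_] := picard_cauchy n t; rewrite mulrAC.
  exists (l1, l2) => n /=; have := l1P n; have := l2P n.
  have -> // : 2 * (M * expR (4 * L * t)) / 2 ^+ n = 2 * (M / 2 ^+ n) * expR (4 * L * t).
  by rewrite !mulrA [_ * expR _ * _]mulrAC.
have [y yP] := choice lim.
(* Since the weight increases with time, convergence is uniform on each half-line bounded above;
   continuity thus passes to the limit. *)
have small (t e : R) : 0 < e -> exists n, forall s : R, s < t ->
    `|(y s).1 - (picard n s).1| < e /\ `|(y s).2 - (picard n s).2| < e.
  move=> e0; have [|n ne] := @div_exp2_small (2 * M * expR (4 * L * t)) e _ e0.
    by rewrite !mulr_ge0 // expR_ge0.
  exists n => s st; have [h1 h2] := yP s n.
  have h3 : 2 * (M / 2 ^+ n) * expR (4 * L * s) < e.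
    apply: le_lt_trans ne; rewrite [leRHS](_ : _ = 2 * (M / 2 ^+ n) * expR (4 * L * t)).
      rewrite ler_wpM2l ?mulr_ge0 ?divr_ge0 ?exprn_ge0 //.
      by rewrite ler_expR ler_pM2l ?mulr_gt0 // ltW.
    by rewrite !mulrA [_ * expR _ * _]mulrAC.
  by split; [exact: le_lt_trans h1 h3 | exact: le_lt_trans h2 h3].
have cy : pcontinuous y.
  split=> t; apply/cvgrPdist_lt => e e0.
    have [|n ne] := small (t + 1) (e / 3); first by rewrite divr_gt0.
    have [cn _] := picard_continuous n; near=> s.
    have [|h1 _] := ne t; first by rewrite ltrDl.
    have [|h2 _] := ne s; first by near: s; apply: lt_nbhsl; rewrite ltrDl.
    have h3 : `|(picard n t).1 - (picard n s).1| < e / 3.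
      by near: s; apply: cvgr_dist_lt; [exact: cn | rewrite divr_gt0].
    by move: h1 h2 h3; rewrite /= !ltr_norml; lra.
  have [|n ne] := small (t + 1) (e / 3); first by rewrite divr_gt0.
  have [_ cn] := picard_continuous n; near=> s.
  have [|_ h1] := ne t; first by rewrite ltrDl.
  have [|_ h2] := ne s; first by near: s; apply: lt_nbhsl; rewrite ltrDl.
  have h3 : `|(picard n t).2 - (picard n s).2| < e / 3.
    by near: s; apply: cvgr_dist_lt; [exact: cn | rewrite divr_gt0].
  by move: h1 h2 h3; rewrite /= !ltr_norml; lra.
have [[c1 c2] z0 d1 d2] := picard_stepP cy.
(* The limit is a fixed point: applying the contraction to [y] and [picard n] keeps [picard_step y]
   close to [picard n.+1], which converges to [y]. *)
have yz (t : R) : picard_step y t = y t.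
  have yz_close n : `|(picard_step y t).1 - (picard n.+1 t).1| <= M / 2 ^+ n * expR (4 * L * t) /\
      `|(picard_step y t).2 - (picard n.+1 t).2| <= M / 2 ^+ n * expR (4 * L * t).
    apply: (picard_step_close (y := y) (z := picard n) (D := M / 2 ^+ n)) => //.
    - by rewrite divr_ge0 // exprn_ge0.
    - exact: picard_continuous.
    - by move=> s _; have [] := yP s n.
    - by move=> s _; have [] := yP s n.
  have close0 (a b : R) (q : nat -> R) :
      (forall n, `|a - q n.+1| <= M / 2 ^+ n * expR (4 * L * t)) ->
      (forall n, `|b - q n| <= 2 * (M / 2 ^+ n) * expR (4 * L * t)) -> a = b.
    move=> aq bq; apply/eqP; rewrite -subr_eq0 -normr_le0 leNgt; apply/negP => ab0.
    have [|n] := @div_exp2_small (2 * M * expR (4 * L * t)) _ _ ab0.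
      by rewrite !mulr_ge0 // expR_ge0.
    apply/negP; rewrite -leNgt.
    have := aq n; have := bq n.+1; rewrite exprS invfM.
    have -> : 2 * (M * (2^-1 / 2 ^+ n)) * expR (4 * L * t) =
        M / 2 ^+ n * expR (4 * L * t) by field.
    have -> : 2 * M * expR (4 * L * t) / 2 ^+ n = M / 2 ^+ n * expR (4 * L * t) + M / 2 ^+ n * expR (4 * L * t) by field.
    by move: (M / _ * _) => D; rewrite !ler_norml; lra.
  apply/eqP; rewrite -pair_eqE /=; apply/andP; split; apply/eqP.
    apply: (close0 _ _ (fun n => (picard n t).1)) => n; first by have [] := yz_close n.
    by have [] := yP t n.
  apply: (close0 _ _ (fun n => (picard n t).2)) => n; first by have [] := yz_close n.
  by have [] := yP t n.
have yzE : picard_step y = y by apply/funext.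
exists y; split=> //; first by rewrite -yz z0.
move=> b; rewrite yzE in d1 d2.
case: cy => cy1 cy2; split.
- exact: continuous_subspaceT.
- exact: continuous_subspaceT.
- by move=> t /andP[t0 _]; exact: d1.
- by move=> t /andP[t0 _]; exact: d2.
Unshelve. all: by end_near. Qed.

End PicardLindelof.

(** * The Hamiltonian flow in the square *)

Section SmoothOnSquare.
Variable R : realType.
Implicit Types (f g fx fy gx gy : R * R -> R) (u v : R * R).

Definition lipschitz_on_square f := exists2 L : R, 0 <= L &
  forall u v, closed_square u -> closed_square v ->
    `|f u - f v| <= L * (`|u.1 - v.1| + `|u.2 - v.2|).

Lemma lipschitz_on_square_bounded f : lipschitz_on_square f ->
  exists2 M : R, 0 <= M & forall u, closed_square u -> `|f u| <= M.
Proof.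
move=> [L L0 fL]; exists (`|f (0, 0)| + L * 2); first by rewrite addr_ge0 // mulr_ge0.
move=> u [u1 u2]; have c0 : closed_square ((0, 0) : R * R) by split; rewrite /= lexx ler01.
have := fL u (0, 0) (conj u1 u2) c0; rewrite /= !subr0.
have h : L * (`|u.1| + `|u.2|) <= L * 2.
  by rewrite ler_wpM2l //; move: u1 u2 => /andP[? ?] /andP[? ?]; rewrite !ger0_norm //; lra.
have := ler_normD (f u - f (0, 0)) (f (0, 0)); rewrite subrK; lra.
Qed.

Lemma lipschitz_on_squareD f g : lipschitz_on_square f -> lipschitz_on_square g ->
  lipschitz_on_square (f \+ g).
Proof.
move=> [L L0 fL] [K K0 gK]; exists (L + K); first exact: addr_ge0.
move=> u v cu cv /=; have := fL u v cu cv; have := gK u v cu cv.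
have := ler_normD (f u - f v) (g u - g v).
by rewrite (_ : f u - f v + _ = f u + g u - (f v + g v)); [lra | ring].
Qed.

Lemma lipschitz_on_squareM f g : lipschitz_on_square f -> lipschitz_on_square g ->
  lipschitz_on_square (f \* g).
Proof.
move=> lf lg; have [M M0 fM] := lipschitz_on_square_bounded lf.
have [N N0 gN] := lipschitz_on_square_bounded lg.
move: lf lg => [L L0 fL] [K K0 gK].
exists (M * K + N * L); first by rewrite addr_ge0 // mulr_ge0.
move=> u v cu cv /=.
rewrite (_ : _ - _ = f u * (g u - g v) + g v * (f u - f v)); last by ring.
rewrite (le_trans (ler_normD _ _)) // !normrM mulrDl -!mulrA.
by apply: lerD; apply: ler_pM => //; [exact: fM | exact: gK | exact: gN | exact: fL].
Qed.

(** The chain rule along curves stands in for differentiability: it is preserved by sums and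
    products and is what conservation of [H] uses. The Lipschitz bounds are confined to the square,
    since polynomials satisfy them only on bounded sets. *)
Definition smooth_on_square f fx fy :=
  [/\ continuous f, lipschitz_on_square f, lipschitz_on_square fx,
      lipschitz_on_square fy &
      forall (y1 y2 : R -> R) (t d1 d2 : R),
        is_derive t 1 y1 d1 -> is_derive t 1 y2 d2 ->
        is_derive t 1 (fun s => f (y1 s, y2 s))
          (fx (y1 t, y2 t) * d1 + fy (y1 t, y2 t) * d2)].

Lemma lipschitz_on_square_cst (c : R) : lipschitz_on_square (fun=> c).
Proof. by exists 0 => // u v _ _; rewrite subrr normr0 mul0r. Qed.

Lemma smooth_cst (c : R) : smooth_on_square (fun=> c) (fun=> 0) (fun=> 0).
Proof.
split; try exact: lipschitz_on_square_cst; first by move=> u; exact: cvg_cst.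
by move=> y1 y2 t d1 d2 _ _; rewrite !mul0r addr0; exact: is_derive_cst.
Qed.

Lemma smooth_fst : smooth_on_square fst (fun=> 1) (fun=> 0).
Proof.
split; try exact: lipschitz_on_square_cst; first by move=> u; exact: cvg_fst.
  by exists 1 => // u v _ _; rewrite mul1r lerDl.
by move=> y1 y2 t d1 d2 h1 _; rewrite mul1r mul0r addr0.
Qed.

Lemma smooth_snd : smooth_on_square snd (fun=> 0) (fun=> 1).
Proof.
split; try exact: lipschitz_on_square_cst; first by move=> u; exact: cvg_snd.
  by exists 1 => // u v _ _; rewrite mul1r lerDr.
by move=> y1 y2 t d1 d2 _ h2; rewrite mul0r mul1r add0r.
Qed.

Lemma smoothD f fx fy g gx gy :
  smooth_on_square f fx fy -> smooth_on_square g gx gy ->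
  smooth_on_square (f \+ g) (fx \+ gx) (fy \+ gy).
Proof.
move=> [cf lf lfx lfy df] [cg lg lgx lgy dg].
split; try exact: lipschitz_on_squareD.
  by move=> u; apply: cvgD; [exact: cf | exact: cg].
move=> y1 y2 t d1 d2 h1 h2; have e1 := df _ _ _ _ _ h1 h2; have e2 := dg _ _ _ _ _ h1 h2.
apply: (is_derive_eq (is_deriveD e1 e2)); rewrite /=; ring.
Qed.

Lemma smoothM f fx fy g gx gy :
  smooth_on_square f fx fy -> smooth_on_square g gx gy ->
  smooth_on_square (f \* g) ((f \* gx) \+ (g \* fx)) ((f \* gy) \+ (g \* fy)).
Proof.
move=> [cf lf lfx lfy df] [cg lg lgx lgy dg].
split.
- by move=> u; apply: cvgM; [exact: cf | exact: cg].
- exact: lipschitz_on_squareM.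
- by apply: lipschitz_on_squareD; exact: lipschitz_on_squareM.
- by apply: lipschitz_on_squareD; exact: lipschitz_on_squareM.
move=> y1 y2 t d1 d2 h1 h2; have e1 := df _ _ _ _ _ h1 h2; have e2 := dg _ _ _ _ _ h1 h2.
apply: (is_derive_eq (is_deriveM e1 e2)); rewrite /GRing.scale /=; ring.
Qed.

Definition smooth f := exists fx fy, smooth_on_square f fx fy.

Lemma smooth_exp f n : smooth f -> smooth (fun u => f u ^+ n).
Proof.
move=> sf; elim: n => [|n [gx [gy IH]]].
  by exists (fun=> 0), (fun=> 0); exact: (smooth_cst 1).
case: sf => fx [fy sf]; rewrite (_ : (fun _ => _) = f \* (fun u => f u ^+ n)).
  by eexists; eexists; exact: (smoothM sf IH).
by apply/funext => u; rewrite exprS.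
Qed.

Lemma smooth_sum (I : Type) (r : seq I) (F : I -> R * R -> R) :
  (forall i, smooth (F i)) -> smooth (fun u => \sum_(i <- r) F i u).
Proof.
move=> sF; elim: r => [|i r [gx [gy IH]]].
  rewrite (_ : (fun _ => _) = fun=> 0).
    by eexists; eexists; exact: smooth_cst.
  by apply/funext => u; rewrite big_nil.
rewrite (_ : (fun _ => _) = F i \+ (fun u => \sum_(j <- r) F j u)).
  by have [fx [fy sf]] := sF i; eexists; eexists; exact: (smoothD sf IH).
by apply/funext => u; rewrite big_cons.
Qed.

Lemma smooth_poly_fun n (a : nat -> nat -> R) : smooth (poly_fun n a).
Proof.
apply: smooth_sum => k; apply: smooth_sum => j.
have [fx [fy sf]] : smooth (fun u => u.1 ^+ (k - j)).
  by apply: smooth_exp; eexists; eexists; exact: smooth_fst.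
have [gx [gy sg]] : smooth (fun u => u.2 ^+ j).
  by apply: smooth_exp; eexists; eexists; exact: smooth_snd.
by eexists; eexists; exact: (smoothM (smoothM (smooth_cst (a k j)) sf) sg).
Qed.

Lemma smooth_partials f fx fy : smooth_on_square f fx fy ->
  partial_x f = fx /\ partial_y f = fy.
Proof.
move=> [_ _ _ _ df]; split; apply/funext => -[x y].
  rewrite /partial_x derive1E /=.
  have := df id (cst y) x 1 0 (is_derive_id _ _) (is_derive_cst _ _ _).
  by rewrite mulr1 mulr0 addr0 => h; rewrite derive_val.
rewrite /partial_y derive1E /=.
have := df (cst x) id y 0 1 (is_derive_cst _ _ _) (is_derive_id _ _).
by rewrite mulr1 mulr0 add0r => h; rewrite derive_val.
Qed.

Lemma smooth_on_square_poly_fun n (a : nat -> nat -> R) :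
  smooth_on_square (poly_fun n a) (partial_x (poly_fun n a)) (partial_y (poly_fun n a)).
Proof.
have [fx [fy sf]] := smooth_poly_fun n a.
by have [-> ->] := smooth_partials sf.
Qed.

Definition clamp (x : R) := Num.max 0 (Num.min 1 x).

Lemma clamp_itv x : 0 <= clamp x <= 1.
Proof. by rewrite /clamp le_max lexx /= ge_max ler01 ge_min lexx. Qed.

Lemma clamp_id x : 0 <= x <= 1 -> clamp x = x.
Proof. by move=> /andP[x0 x1]; rewrite /clamp min_r // max_r. Qed.

Lemma clamp_lip x y : `|clamp x - clamp y| <= `|x - y|.
Proof.
have := ler_norm (x - y); have := ler_norm (y - x); rewrite distrC.
move: `|x - y| => d; rewrite ler_norml /clamp.
have m01 : Num.max 0 1 = 1 :> R by rewrite max_r // ler01.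
case: (leP 1 x) => ?; case: (leP 1 y) => ?; rewrite ?m01;
  case: (leP 0 x) => ?; case: (leP 0 y) => ? ? ?; lra.
Qed.

Definition clamp2 u : R * R := (clamp u.1, clamp u.2).

Lemma clamp2_square u : closed_square (clamp2 u).
Proof. by split; exact: clamp_itv. Qed.

Lemma clamp2_id u : closed_square u -> clamp2 u = u.
Proof. by case: u => x y [x01 y01]; rewrite /clamp2 /= !clamp_id. Qed.

Lemma lipschitz_clamp2 f : lipschitz_on_square f -> exists2 L, 0 <= L &
  forall u v, `|f (clamp2 u) - f (clamp2 v)| <= L * (`|u.1 - v.1| + `|u.2 - v.2|).
Proof.
move=> [L L0 fL]; exists L => // u v.
rewrite (le_trans (fL _ _ (clamp2_square u) (clamp2_square v))) //.
by rewrite ler_wpM2l // lerD // clamp_lip.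
Qed.

End SmoothOnSquare.

(** * Coordinatewise calculus of plane curves *)

Section PlaneCurves.
Variable R : realType.

Lemma is_derive_cvg (V : normedModType R) (f : R -> V) (t : R) (v : V) :
  is_derive t 1 f v <-> (fun h => h^-1 *: (f (h *: 1 + t) - f t)) @ 0^' --> v.
Proof.
split=> [[df <-]|cf]; first exact: df.
by apply: DeriveDef; [exact: (cvgP _ cf) | exact: (cvg_lim _ cf)].
Qed.

Lemma is_derive_fst (y : R -> R * R) (t : R) (v : R * R) :
  is_derive t 1 y v -> is_derive t 1 (fst \o y) v.1.
Proof.
move=> /is_derive_cvg cf; apply/is_derive_cvg.
exact: (cvg_comp _ _ cf cvg_fst).
Qed.

Lemma is_derive_snd (y : R -> R * R) (t : R) (v : R * R) :
  is_derive t 1 y v -> is_derive t 1 (snd \o y) v.2.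
Proof.
move=> /is_derive_cvg cf; apply/is_derive_cvg.
exact: (cvg_comp _ _ cf cvg_snd).
Qed.

Lemma is_derive_curve (y : R -> R * R) (t : R) (v : R * R) :
  is_derive t 1 (fst \o y) v.1 -> is_derive t 1 (snd \o y) v.2 ->
  is_derive t 1 y v.
Proof.
case: v => v1 v2 /is_derive_cvg c1 /is_derive_cvg c2; apply/is_derive_cvg.
refine (cvg_trans _ (cvg_pair c1 c2)).
by apply: near_eq_cvg; exact: nearW.
Qed.

Lemma within_continuous_fst (y : R -> R * R) (A : set R) :
  {within A, continuous y} -> {within A, continuous (fst \o y)}.
Proof. by move=> cy t; exact: (cvg_comp _ _ (cy t) cvg_fst). Qed.

Lemma within_continuous_snd (y : R -> R * R) (A : set R) :
  {within A, continuous y} -> {within A, continuous (snd \o y)}.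
Proof. by move=> cy t; exact: (cvg_comp _ _ (cy t) cvg_snd). Qed.

Lemma within_continuous_curve (y : R -> R * R) (A : set R) :
  {within A, continuous (fst \o y)} -> {within A, continuous (snd \o y)} ->
  {within A, continuous y}.
Proof.
move=> c1 c2; rewrite (_ : y = fun s => ((fst \o y) s, (snd \o y) s)).
  by move=> t; exact: cvg_pair (c1 t) (c2 t).
by apply/funext => s /=; case: (y s).
Qed.

End PlaneCurves.

(** * The flow of the extended field and conservation of energy *)

Section HamiltonianFlow.
Variables (R : realType) (H : R * R -> R).
Hypothesis Hsmooth : smooth_on_square H (partial_x H) (partial_y H).
Implicit Types (y z : R -> R * R) (p q u : R * R).

(* The field is frozen outside the square to make it globally Lipschitz. *)
Definition ham1 u := - partial_y H (clamp2 u).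
Definition ham2 u := partial_x H (clamp2 u).

Lemma ham_bounds : exists L M : R, [/\ 1 <= L,
  forall u v, `|ham1 u - ham1 v| <= L * (`|u.1 - v.1| + `|u.2 - v.2|),
  forall u v, `|ham2 u - ham2 v| <= L * (`|u.1 - v.1| + `|u.2 - v.2|),
  forall u, `|ham1 u| <= M & forall u, `|ham2 u| <= M].
Proof.
case: Hsmooth => _ _ lx ly _.
have [M Mx xM] := lipschitz_on_square_bounded lx.
have [N Ny yN] := lipschitz_on_square_bounded ly.
have [L L0 xL] := lipschitz_clamp2 lx; have [K K0 yK] := lipschitz_clamp2 ly.
exists (1 + L + K), (M + N); split.
- by lra.
- move=> u v; rewrite /ham1 -opprD normrN (le_trans (yK u v)) //.
  by rewrite ler_wpM2r ?addr_ge0 //; lra.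
- move=> u v; rewrite /ham2 (le_trans (xL u v)) //.
  by rewrite ler_wpM2r ?addr_ge0 //; lra.
- by move=> u; rewrite normrN (le_trans (yN _ (clamp2_square u))) // lerDr.
- by move=> u; rewrite (le_trans (xM _ (clamp2_square u))) // lerDl.
Qed.

Definition ham_flow y := [/\ pcontinuous y & forall b, solves ham1 ham2 y b].

Lemma ham_flow_exists u : exists2 y, ham_flow y & y 0 = u.
Proof.
have [L [M [L1 h1 h2 m1 m2]]] := ham_bounds.
by have [y [cy y0 sy]] := picard_lindelof L1 h1 h2 m1 m2 u; exists y.
Qed.

Lemma solves_unique y z b : 0 <= b -> solves ham1 ham2 y b -> solves ham1 ham2 z b ->
  y 0 = z 0 -> y b = z b.
Proof.
have [L [M [L1 h1 h2 m1 m2]]] := ham_bounds.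
move=> b0 sy sz yz; have := solves_dependence L1 h1 h2 b0 sy sz.
rewrite yz !subrr expr0n /= addr0 mul0r => le0.
have := sqr_ge0 ((y b).1 - (z b).1); have := sqr_ge0 ((y b).2 - (z b).2) => e2 e1.
have : ((y b).1 - (z b).1) ^+ 2 = 0 by apply/eqP; rewrite eq_le; lra.
have : ((y b).2 - (z b).2) ^+ 2 = 0 by apply/eqP; rewrite eq_le; lra.
move=> /eqP; rewrite sqrf_eq0 => /eqP/subr0_eq e2' /eqP.
rewrite sqrf_eq0 => /eqP/subr0_eq e1'.
by rewrite [LHS]surjective_pairing e1' e2' -surjective_pairing.
Qed.

Lemma solves_sub y b c : c <= b -> solves ham1 ham2 y b -> solves ham1 ham2 y c.
Proof.
move=> cb [c1 c2 d1 d2].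
have sub : (`[0, c]%classic : set R) `<=` `[0, b]%classic.
  by move=> t /=; rewrite !in_itv /= => /andP[-> /le_trans ->].
split.
- exact: continuous_subspaceW c1.
- exact: continuous_subspaceW c2.
- by move=> t /andP[t0 tc]; apply: d1; rewrite t0 (lt_le_trans tc).
- by move=> t /andP[t0 tc]; apply: d2; rewrite t0 (lt_le_trans tc).
Qed.

Lemma ham_flow_continuous_dependence (b e : R) : 0 <= b -> 0 < e ->
  exists2 d, 0 < d & forall y z, ham_flow y -> ham_flow z ->
    `|(y 0).1 - (z 0).1| < d -> `|(y 0).2 - (z 0).2| < d ->
    forall t, 0 <= t <= b -> `|(y t).1 - (z t).1| < e /\ `|(y t).2 - (z t).2| < e.
Proof.
have [L [M [L1 h1 h2 m1 m2]]] := ham_bounds.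
have L0 : 0 < L by exact: lt_le_trans L1.
move=> b0 e0; pose E := expR (4 * L * b).
have E1 : 1 <= E by rewrite -expR0 ler_expR !mulr_ge0 // ltW.
have E0 : 0 < E by rewrite expR_gt0.
(* Both coordinates within [d] give a squared distance below 2 d^2. As [1 <= E], it grows to at most
   2 (d E)^2, which is half of e^2. *)
exists (e / (2 * E)); first by rewrite divr_gt0 // mulr_gt0.
set d := e / _; have d0 : 0 < d by rewrite divr_gt0 // mulr_gt0.
have dE : d * E = e / 2 by rewrite /d; field; rewrite gt_eqF.
move=> y z [_ sy] [_ sz] yz1 yz2 t /andP[t0 tb].
have := solves_dependence L1 h1 h2 t0 (sy t) (sz t).
have sq (x r : R) : `|x| < r -> x ^+ 2 < r ^+ 2.
  by move=> xr; rewrite -(real_normK (num_real x)) ltrXn2r // (le_lt_trans _ xr).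
have lt2 : ((y 0).1 - (z 0).1) ^+ 2 + ((y 0).2 - (z 0).2) ^+ 2 < 2 * d ^+ 2.
  by have := sq _ _ yz1; have := sq _ _ yz2; lra.
have le2 : expR (4 * L * t) <= E by rewrite ler_expR ler_pM2l // mulr_gt0.
set X := ((y 0).1 - _) ^+ 2 + _ in lt2 *.
have X0 : 0 <= X by rewrite addr_ge0 // sqr_ge0.
have bnd : X * expR (4 * L * t) < e ^+ 2.
  apply: (@le_lt_trans _ _ (X * E)); first by rewrite ler_wpM2l.
  have lt3 : X * E < 2 * d ^+ 2 * E by rewrite ltr_pM2r.
  have : d * d * E <= d * d * E * E.
    have h0 : 0 <= d * d * E by apply: mulr_ge0; [apply: mulr_ge0|]; exact: ltW.
    exact: ler_peMr.
  have -> : d * d * E * E = e ^+ 2 / 4.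
    by rewrite (_ : _ * E * E = (d * E) ^+ 2); [rewrite dE; field | ring].
  have : 0 < e ^+ 2 by rewrite exprn_gt0.
  by rewrite expr2 in lt3; lra.
have back (x r : R) : 0 <= r -> x ^+ 2 < r ^+ 2 -> `|x| < r.
  by move=> r0; rewrite -(real_normK (num_real x)) ltr_sqr ?nnegrE.
have := sqr_ge0 ((y t).1 - (z t).1); have := sqr_ge0 ((y t).2 - (z t).2) => s2 s1 le3.
by split; apply: back; rewrite ?(ltW e0) //; lra.
Qed.

Lemma trajectory_arc_solves p q A : trajectory_arc H p q A ->
  exists T y, [/\ 0 < T, solves ham1 ham2 y T,
    forall t, 0 < t < T -> open_square (y t), y 0 = p /\ y T = q & A = y @` `[0, T]].
Proof.
move=> [T [y [T0 cy dy ypq AE]]]; exists T, y; split => //; last first.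
  by move=> t /dy[].
have inner t : 0 < t < T -> closed_square (y t).
  by move=> /dy[[/andP[/ltW a /ltW b] /andP[/ltW c /ltW d]] _]; rewrite /closed_square /= a b c d.
split.
- exact: within_continuous_fst.
- exact: within_continuous_snd.
- move=> t tT; rewrite /ham1 clamp2_id; last exact: inner.
  by have [_ /is_derive_fst] := dy t tT.
- move=> t tT; rewrite /ham2 clamp2_id; last exact: inner.
  by have [_ /is_derive_snd] := dy t tT.
Qed.

Lemma trajectory_arc_flow y T : 0 < T -> ham_flow y ->
  (forall t, 0 < t < T -> open_square (y t)) ->
  trajectory_arc H (y 0) (y T) (y @` `[0, T]).
Proof.
move=> T0 [[c1 c2] sy] oy; exists T, y; split => //.
  by apply: within_continuous_curve; exact: continuous_subspaceT.
move=> t tT; split; first exact: oy.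
have ct : closed_square (y t).
  by have [/andP[/ltW a /ltW b] /andP[/ltW c /ltW d]] := oy t tT; rewrite /closed_square /= a b c d.
have [_ _ /(_ t tT) d1 /(_ t tT) d2] := sy T.
by rewrite /ham1 /ham2 (clamp2_id ct) in d1 d2; exact: is_derive_curve.
Qed.

Lemma ham_conserved y b : 0 <= b -> solves ham1 ham2 y b ->
  (forall t, 0 <= t <= b -> closed_square (y t)) -> H (y b) = H (y 0).
Proof.
move=> b0 [c1 c2 d1 d2] yin; case: Hsmooth => cH _ _ _ dH.
have cHy : {within `[0, b], continuous (H \o y)}.
  have wc := within_continuous_curve c1 c2.
  move=> t; apply: (@continuous_comp _ _ _ (y : subspace `[0, b] -> _) H t).
    exact: wc.
  exact: cH.
have dHy t : 0 < t < b -> is_derive t 1 (H \o y) 0.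
  move=> tb; have := dH (fst \o y) (snd \o y) t _ _ (d1 t tb) (d2 t tb).
  rewrite (_ : (fun s : R => H (_, _)) = H \o y); last first.
    by apply/funext => s /=; case: (y s).
  have /clamp2_id yt : closed_square (y t).
    by apply: yin; move: tb => /andP[/ltW -> /ltW ->].
  rewrite /ham1 /ham2 yt /= -surjective_pairing => h.
  by apply: is_derive_eq h _; ring.
have c0 : {within `[0, b], continuous (fun=> 0 : R)}.
  by apply: continuous_subspaceT => t; exact: cvg_cst.
have z0 t : 0 < t < b -> is_derive t (1 : R) (fun=> 0 : R) (0 : R).
  by move=> _; exact: is_derive_cst.
have z1 t : 0 < t < b -> `|0 : R| <= 0 by rewrite normr0.
have := @derive_comparison_abs R (H \o y) (fun=> 0) (fun=> 0) (fun=> 0) 0 b b0 cHy c0 dHy z0 z1.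
by rewrite subrr normr_le0 subr_eq0 => /eqP.
Qed.

End HamiltonianFlow.

(** * Perturbation of trajectory arcs *)

Section Edges.
Variables (R : realType) (H : R * R -> R).
Hypothesis Hsmooth : smooth_on_square H (partial_x H) (partial_y H).
Implicit Types (y z : R -> R * R) (p q u w : R * R) (e : bool * bool).

(* The four edges are indexed by a pair of booleans: whether the edge is
   vertical, and whether it lies on the side of coordinate 1. *)
Definition gap e u : R :=
  let c := if e.1 then u.1 else u.2 in if e.2 then 1 - c else c.

(** The derivative of [gap e] along the extended field: positive where trajectories enter through
    the edge, negative where they leave. *)
Definition dgap e u : R :=
  let d := if e.1 then ham1 H u else ham2 H u in if e.2 then - d else d.

Definition in_edge e u := gap e u = 0 /\ forall e', e' != e -> 0 < gap e' u.

Lemma open_squareP u : open_square u <-> forall e, 0 < gap e u.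
Proof.
rewrite /open_square /gap; split => [[/andP[a b] /andP[c d]] [[] []] /=|gu] //=; try lra.
have := gu (true, true); have := gu (true, false).
have := gu (false, true); have := gu (false, false); rewrite /=.
by split; apply/andP; split; lra.
Qed.

Lemma closed_squareP u : closed_square u <-> forall e, 0 <= gap e u.
Proof.
rewrite /closed_square /gap; split => [[/andP[a b] /andP[c d]] [[] []] /=|gu] //=; try lra.
have := gu (true, true); have := gu (true, false).
have := gu (false, true); have := gu (false, false); rewrite /=.
by split; apply/andP; split; lra.
Qed.

Lemma in_edge_closed_square e u : in_edge e u -> closed_square u.
Proof.
move=> [e0 eu]; apply/closed_squareP => e'.
by have [->|/eu /ltW //] := eqVneq e' e; rewrite e0.
Qed.

Lemma gap_ball e u w (r : R) : ball u r w -> `|gap e u - gap e w| < r.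
Proof.
move=> [h1 h2]; case: e => -[] []; rewrite /gap /=; try assumption.
  by rewrite (_ : _ - _ = - (u.1 - w.1)); [rewrite normrN; exact: h1 | ring].
by rewrite (_ : _ - _ = - (u.2 - w.2)); [rewrite normrN; exact: h2 | ring].
Qed.

Lemma gap_continuous e : continuous (gap e).
Proof.
move=> u; case: e => -[] [] /=; rewrite /gap /=.
- by apply: cvgB; [exact: cvg_cst | exact: cvg_fst].
- exact: cvg_fst.
- by apply: cvgB; [exact: cvg_cst | exact: cvg_snd].
- exact: cvg_snd.
Qed.

Lemma lipschitz_continuous (f : R * R -> R) (L : R) : 0 < L ->
  (forall u v, `|f u - f v| <= L * (`|u.1 - v.1| + `|u.2 - v.2|)) -> continuous f.
Proof.
move=> L0 fL u; apply/cvgrPdist_lt => r r0.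
have d0 : 0 < r / L / 2 by rewrite !divr_gt0.
near=> w; have [h1 h2] : ball u (r / L / 2) w.
  by near: w; exact: (nbhsx_ballx u _ d0).
rewrite (le_lt_trans (fL _ _)) // mulrC -ltr_pdivlMr //.
have {h1} : `|u.1 - w.1| < r / L / 2 by exact: h1.
have {h2} : `|u.2 - w.2| < r / L / 2 by exact: h2.
lra.
Unshelve. all: by end_near. Qed.

Lemma dgap_continuous e : continuous (dgap e).
Proof.
have [L [M [L1 l1 l2 _ _]]] := ham_bounds Hsmooth.
have L0 : 0 < L by exact: lt_le_trans L1.
have c1 := lipschitz_continuous L0 l1; have c2 := lipschitz_continuous L0 l2.
move=> u; case: e => -[] [] /=; rewrite /dgap /=.
- by apply: cvgN; exact: c1.
- exact: c1.
- by apply: cvgN; exact: c2.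
- exact: c2.
Qed.

Lemma gap_derive e y b t : solves (ham1 H) (ham2 H) y b -> 0 < t < b ->
  is_derive t 1 (gap e \o y) (dgap e (y t)).
Proof.
move=> [_ _ d1 d2] tb; have h1 := d1 t tb; have h2 := d2 t tb.
case: e => -[] []; rewrite /dgap /gap /=.
- have := @is_deriveB _ _ _ (cst (1 : R)) (fst \o y) t 1 _ _ (is_derive_cst (1 : R) t 1) h1.
  by rewrite sub0r.
- exact: h1.
- have := @is_deriveB _ _ _ (cst (1 : R)) (snd \o y) t 1 _ _ (is_derive_cst (1 : R) t 1) h2.
  by rewrite sub0r.
- exact: h2.
Qed.

Lemma gap_flow_continuous e y : pcontinuous y -> continuous (gap e \o y).
Proof.
move=> [c1 c2] t; case: e => -[] []; rewrite /gap /=.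
- by apply: cvgB; [exact: cvg_cst | exact: c1].
- exact: c1.
- by apply: cvgB; [exact: cvg_cst | exact: c2].
- exact: c2.
Qed.

Lemma gap_MVT e y (s t : R) : ham_flow H y -> 0 <= s -> s < t ->
  exists2 c, s < c < t & gap e (y t) - gap e (y s) = dgap e (y c) * (t - s).
Proof.
move=> [cy sy] s0 st.
have [||c] := @MVT R (gap e \o y) (dgap e \o y) s t st.
- move=> c; rewrite in_itv /= => /andP[sc ct].
  by apply: (gap_derive e (sy t)); rewrite (le_lt_trans s0 sc).
- by apply: continuous_subspaceT; exact: gap_flow_continuous.
by rewrite in_itv /= => cst E; exists c.
Qed.

Lemma flow_near y (s r : R) : pcontinuous y -> 0 < r ->
  exists2 d, 0 < d & forall t, `|t - s| <= d -> ball (y s) r (y t).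
Proof.
move=> [c1 c2] r0.
have : \forall t \near s, ball (y s) r (y t).
  near=> t; split.
    by near: t; move/cvgrPdist_lt: (c1 s) => /(_ r r0).
  by near: t; move/cvgrPdist_lt: (c2 s) => /(_ r r0).
move=> /nbhs_ballP[d /= d0 hd]; exists (d / 2); first by rewrite divr_gt0.
move=> t ts; apply: hd; rewrite /ball /= distrC; lra.
Unshelve. all: by end_near. Qed.

(* The trajectories cross the edge inwards if [s = false], outwards otherwise. *)
Lemma edge_nbhs (s : bool) e p : in_edge e p -> 0 < (-1) ^+ s * dgap e p ->
  exists2 r, 0 < r & forall u, ball p r u ->
    0 < (-1) ^+ s * dgap e u /\ forall e', e' != e -> 0 < gap e' u.
Proof.
move=> [_ pe] dp.
have h1 : \forall u \near p, 0 < (-1) ^+ s * dgap e u.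
  have cd : (fun u => (-1) ^+ s * dgap e u) @ nbhs p --> (-1) ^+ s * dgap e p.
    by apply: cvgM; [exact: cvg_cst | exact: dgap_continuous].
  exact: (cvgr_gt _ cd).
have h2 e' : \forall u \near p, e' != e -> 0 < gap e' u.
  have [->|ne] := eqVneq e' e; first by near=> u.
  near=> u => _; near: u.
  exact: (cvgr_gt _ (@gap_continuous e' p) _ (pe _ ne)).
have : \forall u \near p, 0 < (-1) ^+ s * dgap e u /\ forall e', e' != e -> 0 < gap e' u.
  have a := h2 (true, true); have b := h2 (true, false).
  have c := h2 (false, true); have d := h2 (false, false).
  near=> u; split; first by near: u.
  by case=> -[] []; near: u; [exact: a | exact: b | exact: c | exact: d].
by move=> /nbhs_ballP[r r0 hr]; exists r.
Unshelve. all: by end_near. Qed.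

Lemma mid_gap y (a b : R) : pcontinuous y -> a <= b ->
  (forall t, a <= t <= b -> open_square (y t)) ->
  exists2 m, 0 < m & forall e t, a <= t <= b -> m <= gap e (y t).
Proof.
move=> cy ab oy.
have M e : exists2 m, 0 < m & forall t, a <= t <= b -> m <= gap e (y t).
  have [|c] := @EVT_min R (gap e \o y) a b ab.
    by apply: continuous_subspaceT; exact: gap_flow_continuous.
  rewrite in_itv /= => cab hc; exists (gap e (y c)).
    by have /open_squareP := oy c cab; apply.
  by move=> t tab; apply: hc; rewrite in_itv.
have [a1 a10 h1] := M (true, true); have [a2 a20 h2] := M (true, false).
have [a3 a30 h3] := M (false, true); have [a4 a40 h4] := M (false, false).
exists (Num.min (Num.min a1 a2) (Num.min a3 a4)); first by rewrite !lt_min a10 a20 a30 a40.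
move=> e t tab; case: e => -[] []; rewrite !ge_min ?h1 ?h2 ?h3 ?h4 ?orbT //.
Qed.

End Edges.

Section Perturbation.
Variables (R : realType) (H : R * R -> R).
Hypothesis Hsmooth : smooth_on_square H (partial_x H) (partial_y H).
Implicit Types (y z : R -> R * R) (p q u w : R * R) (e : bool * bool).

Lemma edge_nbhs_in e p : in_edge e p -> 0 < dgap H e p ->
  exists2 r, 0 < r & forall u, ball p r u ->
    0 < dgap H e u /\ forall e', e' != e -> 0 < gap e' u.
Proof.
move=> pe dp; have [|r r0 hr] := @edge_nbhs _ _ Hsmooth false e p pe.
  by rewrite expr0 mul1r.
by exists r => // u /hr; rewrite expr0 mul1r.
Qed.

Lemma edge_nbhs_out e p : in_edge e p -> dgap H e p < 0 ->
  exists2 r, 0 < r & forall u, ball p r u ->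
    dgap H e u < 0 /\ forall e', e' != e -> 0 < gap e' u.
Proof.
move=> pe dp; have [|r r0 hr] := @edge_nbhs _ _ Hsmooth true e p pe.
  by rewrite expr1 mulN1r oppr_gt0.
by exists r => // u /hr; rewrite expr1 mulN1r oppr_gt0.
Qed.

Lemma ball_half u v w (r : R) : ball u (r / 2) v -> ball v (r / 2) w -> ball u r w.
Proof. by move=> h1 h2; rewrite [r]splitr; exact: ball_triangle h1 h2. Qed.

(** Three time windows are treated separately. Near 0 only the entry edge is close, and its gap
    grows; in the middle [phi] stays at a fixed distance from all edges; near [T] only the exit edge
    is close, and its gap decreases through zero. *)
Lemma flow_perturbation (phi : R -> R * R) (T eps : R) ep eq :
  ham_flow H phi -> 0 < T -> (forall t, 0 < t < T -> open_square (phi t)) ->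
  in_edge ep (phi 0) -> in_edge eq (phi T) ->
  0 < dgap H ep (phi 0) -> dgap H eq (phi T) < 0 -> 0 < eps ->
  exists2 d, 0 < d & forall y, ham_flow H y -> gap ep (y 0) = 0 ->
    ball (phi 0) d (y 0) -> exists T',
    [/\ 0 < T', forall t, 0 < t < T' -> open_square (y t), gap eq (y T') = 0,
        ball (phi T) eps (y T') &
        forall t, 0 <= t <= T' -> exists2 s, 0 <= s <= T & ball (phi s) eps (y t)].
Proof.
move=> fphi T0 ophi pe qe dp dq eps0.
have [r1 r10 hr1] := edge_nbhs_in pe dp.
have [r2 r20 hr2] := edge_nbhs_out qe dq.
pose r := Num.min (Num.min r1 r2) eps.
have r0 : 0 < r by rewrite !lt_min r10 r20.
have [rr1 rr2 reps] : [/\ r <= r1, r <= r2 & r <= eps].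
  by split; rewrite !ge_min lexx ?orbT.
have {hr1} hp u : ball (phi 0) r u -> 0 < dgap H ep u /\ forall e', e' != ep -> 0 < gap e' u.
  by move=> /(le_ball rr1); exact: hr1.
have {hr2} hq u : ball (phi T) r u -> dgap H eq u < 0 /\ forall e', e' != eq -> 0 < gap e' u.
  by move=> /(le_ball rr2); exact: hr2.
have cphi : pcontinuous phi by case: fphi.
have rh0 : 0 < r / 2 by rewrite divr_gt0.
have [t1 t10 ht1] := flow_near 0 cphi rh0.
have [t2 t20 ht2] := flow_near T cphi rh0.
(* The bound [T / 3] keeps the initial and final windows disjoint. *)
pose tau := Num.min (Num.min t1 t2) (T / 3).
have tau0 : 0 < tau by rewrite !lt_min t10 t20 divr_gt0.
have [taut1 taut2 tauT] : [/\ tau <= t1, tau <= t2 & tau <= T / 3].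
  by split; rewrite !ge_min lexx ?orbT.
have near0 t : 0 <= t <= tau -> ball (phi 0) (r / 2) (phi t).
  move=> /andP[a b]; apply: ht1; rewrite subr0 ger0_norm //; exact: le_trans taut1.
have nearT t : T - tau <= t <= T + tau -> ball (phi T) (r / 2) (phi t).
  move=> /andP[a b]; apply: ht2; rewrite ler_norml; apply/andP; split; clear -a b taut2; lra.
have half_r u v : ball u (r / 2) v -> ball u r v.
  by apply: le_ball; clear -r0; lra.
have [|t|m m0 hm] := @mid_gap _ phi tau (T - tau) cphi; first by clear -tauT T0; lra.
  by move=> /andP[a b]; apply: ophi; apply/andP; split; clear -a b tau0 tauT T0; lra.
(* The extended field carries [phi] strictly beyond the exit edge; nearby solutions then cross it
   too, and the intermediate value theorem gives their exit time. *)
have eta0 : gap eq (phi (T + tau)) < 0.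
  have [||c /andP[c1 c2]] := @gap_MVT _ H eq phi T (T + tau) fphi; first exact: ltW.
    by clear -tau0; lra.
  case: qe => -> _; rewrite subr0 => ->.
  have [|dc _] := hq (phi c).
    by apply: half_r; apply: nearT; apply/andP; split; clear -c1 c2 tau0; lra.
  by rewrite pmulr_llt0 // addrAC subrr add0r.
(* The three bounds keep a nearby solution in the neighborhoods of the two ends, inside the square
   during the middle window, and outside it at time [T + tau]. *)
pose rho := Num.min (r / 2) (Num.min m (- gap eq (phi (T + tau)))).
have rho0 : 0 < rho by rewrite !lt_min rh0 m0 oppr_gt0.
have [rho1 rho2 rho3] : [/\ rho <= r / 2, rho <= m & rho <= - gap eq (phi (T + tau))].
  by split; rewrite !ge_min lexx ?orbT.
have Tt0 : 0 <= T + tau by clear -tau0 T0; lra.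
have [d d0 hd] := ham_flow_continuous_dependence Hsmooth Tt0 rho0.
exists d => // y fy y0 [b1 b2].
have cl t : 0 <= t <= T + tau -> ball (phi t) rho (y t).
  by move=> tT; have [] := hd _ _ fphi fy b1 b2 t tT.
have clr t : 0 <= t <= T + tau -> ball (phi t) (r / 2) (y t).
  by move=> /cl; exact: le_ball.
have yp t : 0 <= t <= tau -> ball (phi 0) r (y t).
  move=> tt; apply: ball_half (near0 t tt) (clr t _).
  by case/andP: tt => a b; apply/andP; split; clear -a b tau0 tauT T0; lra.
have yq t : T - tau <= t <= T + tau -> ball (phi T) r (y t).
  move=> tt; apply: ball_half (nearT t tt) (clr t _).
  by case/andP: tt => a b; apply/andP; split; clear -a b tau0 tauT T0; lra.
have gclose e t : 0 <= t <= T + tau -> `|gap e (phi t) - gap e (y t)| < rho.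
  by move=> /cl; exact: gap_ball.
have open_start t : 0 < t <= tau -> open_square (y t).
  move=> /andP[a b]; apply/open_squareP => e.
  have [->|ne] := eqVneq e ep; last first.
    have yt : ball (phi 0) r (y t) by apply: yp; rewrite b ltW.
    by have [_] := hp (y t) yt; apply.
  have [c /andP[c1 c2]] := @gap_MVT _ H ep y 0 t fy (lexx 0) a.
  rewrite y0 !subr0 => ->; rewrite mulr_gt0 //.
  have yc : ball (phi 0) r (y c) by apply: yp; rewrite (ltW c1) (ltW (lt_le_trans c2 b)).
  by have [] := hp (y c) yc.
have open_mid t : tau <= t <= T - tau -> open_square (y t).
  move=> /andP[a b]; apply/open_squareP => e.
  have h1 : m <= gap e (phi t) by apply: hm; rewrite a b.
  have h2 : `|gap e (phi t) - gap e (y t)| < rho 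
    by apply: gclose; apply/andP; split; clear -a b tau0 tauT T0; lra.
  by move: h2; rewrite ltr_norml; clear -h1 rho2; lra.
have yend : gap eq (y (T + tau)) < 0.
  have h2 : `|gap eq (phi (T + tau)) - gap eq (y (T + tau))| < rho.
    by apply: gclose; rewrite Tt0 lexx.
  by move: h2; rewrite ltr_norml; clear -rho3; lra.
have ymid : 0 < gap eq (y (T - tau)).
  have /open_squareP -> // : open_square (y (T - tau)).
  by apply: open_mid; apply/andP; split; clear -tau0 tauT T0; lra.
have [|||T'] := @IVT R (gap eq \o y) (T - tau) (T + tau) 0; first by clear -tau0; lra.
- apply: continuous_subspaceT; apply: gap_flow_continuous; by case: fy.
- by rewrite /= ge_min le_max (ltW yend) (ltW ymid) orbT.
rewrite in_itv /= => /andP[T'1 T'2] gT'.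
have T'1' : T - tau < T'.
  by rewrite lt_neqAle T'1 andbT; apply: contraTneq ymid => ->; rewrite gT' ltxx.
have T'0 : 0 < T' by clear -T'1' tauT T0; lra.
exists T'; split => //.
- move=> t /andP[t0 tT'].
  have [h|h] := leP t tau; first by apply: open_start; rewrite t0.
  have [h'|h'] := leP t (T - tau); first by apply: open_mid; rewrite h' ltW.
  apply/open_squareP => e.
  have tq : T - tau <= t <= T + tau.
    by apply/andP; split; clear -h' tT' T'2; lra.
  have [->|ne] := eqVneq e eq; last by have [_] := hq (y t) (yq t tq); apply.
  have [c /andP[c1 c2]] := @gap_MVT _ H eq y t T' fy (ltW t0) tT'.
  rewrite gT' sub0r => E.
  have [|dc _] := hq (y c); first by apply: yq; apply/andP; split; clear -c1 c2 h' T'2; lra.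
  have : dgap H eq (y c) * (T' - t) < 0 by rewrite pmulr_llt0 // subr_gt0.
  by rewrite -E oppr_lt0.
- by apply: (le_ball reps); apply: yq; rewrite T'1.
- move=> t /andP[t0 tT'].
  (* After time [T] the reference solution has left the arc, so its end [phi T] serves for
     comparison. *)
  have [h|h] := leP t T.
    exists t; first by rewrite t0.
    apply: (@le_ball _ _ _ (r / 2)); first by clear -reps r0; lra.
    by apply: clr; rewrite t0 /=; clear -h tau0; lra.
  exists T; first by rewrite lexx ltW.
  by apply: (le_ball reps); apply: yq; apply/andP; split; clear -h tT' T'2 tau0; lra.
Qed.

End Perturbation.

(** * Arcs as pieces of the global flow *)

Section Arcs.
Variables (R : realType) (H : R * R -> R).
Hypothesis Hsmooth : smooth_on_square H (partial_x H) (partial_y H).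
Implicit Types (y z : R -> R * R) (p q u w : R * R) (e : bool * bool).

(** By uniqueness the parametrization of an arc may be replaced by a global solution, which
    continues past the end of the arc. *)
Lemma trajectory_arc_flowE p q A : trajectory_arc H p q A ->
  exists T y, [/\ 0 < T, ham_flow H y, forall t, 0 < t < T -> open_square (y t),
    y 0 = p /\ y T = q & A = y @` `[0, T]].
Proof.
move=> /trajectory_arc_solves[T [y [T0 sy oy [y0 yT] AE]]].
have [z fz z0] := ham_flow_exists Hsmooth p.
have zy t : 0 <= t <= T -> z t = y t.
  move=> /andP[t0 tT]; apply: (solves_unique Hsmooth t0); last by rewrite z0.
    by case: fz.
  exact: solves_sub sy.
exists T, z; split => //.
- by move=> t /andP[t0 tT]; rewrite zy ?(ltW t0) ?(ltW tT) //; apply: oy; rewrite t0.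
- by split => //; rewrite zy // lexx ltW.
- rewrite AE; apply/seteqP; split => [_ [t tT <-]|_ [t tT <-]]; exists t => //;
    by rewrite zy //; move: tT; rewrite /= in_itv.
Qed.

(** Both arcs follow the same solution, and each stops at its first positive time outside the open
    square. *)
Lemma trajectory_arc_unique p q q' A A' : trajectory_arc H p q A ->
  trajectory_arc H p q' A' -> ~ open_square q -> ~ open_square q' -> A = A'.
Proof.
move=> /trajectory_arc_flowE[T [y [T0 fy oy [y0 yT] AE]]].
move=> /trajectory_arc_flowE[T' [z [T'0 fz oz [z0 zT] A'E]]] nq nq'.
have yz t : 0 <= t -> y t = z t.
  move=> t0; apply: (solves_unique Hsmooth t0); last by rewrite y0.
    by case: fy.
  by case: fz.
have TT' : T = T'.
  apply/eqP; rewrite eq_le !leNgt; apply/andP; split; apply/negP => lt.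
    by apply: nq'; rewrite -zT -yz ?(ltW T'0) //; apply: oy; rewrite T'0.
  by apply: nq; rewrite -yT yz ?(ltW T0) //; apply: oz; rewrite T0.
rewrite AE A'E TT'; apply/seteqP; split => [_ [t tT <-]|_ [t tT <-]]; exists t => //;
  by rewrite yz //; move: tT; rewrite /= in_itv /= => /andP[].
Qed.

Lemma trajectory_arc_conserved p q A : trajectory_arc H p q A ->
  closed_square p -> closed_square q -> H q = H p.
Proof.
move=> /trajectory_arc_flowE[T [y [T0 [_ sy] oy [y0 yT] AE]]] cp cq.
rewrite -yT -y0; apply: (ham_conserved Hsmooth (ltW T0) (sy T)).
move=> t /andP[]; rewrite !le_eqVlt => /predU1P[<-|t0]; first by rewrite y0.
move=> /predU1P[->|tT]; first by rewrite yT.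
have /open_squareP o : open_square (y t) by apply: oy; rewrite t0.
by apply/closed_squareP => e; exact: ltW.
Qed.

(** If the field pointed outwards at the start, the mean value theorem would make the gap
    nonpositive just afterwards. *)
Lemma flow_enters y (T : R) e : ham_flow H y -> 0 < T ->
  (forall t, 0 < t < T -> open_square (y t)) ->
  in_edge e (y 0) -> dgap H e (y 0) != 0 -> 0 < dgap H e (y 0).
Proof.
move=> fy T0 oy pe; rewrite neq_lt => /orP[dp|//].
have [r r0 hr] := edge_nbhs_out Hsmooth pe dp.
have cy : pcontinuous y by case: fy.
have [d d0 hd] := flow_near 0 cy r0.
pose t := Num.min d (T / 2).
have t0 : 0 < t by rewrite lt_min d0 divr_gt0.
have [td tT] : t <= d /\ t <= T / 2 by split; rewrite ge_min lexx ?orbT.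
have tT' : t < T by apply: le_lt_trans tT _; rewrite ltr_pdivrMr // mulr_natr mulr2n ltrDl.
have [c /andP[c1 c2]] := @gap_MVT _ H e y 0 t fy (lexx 0) t0.
case: pe => -> _; rewrite !subr0 => E.
have [|dc _] := hr (y c).
  by apply: hd; rewrite subr0 gtr0_norm // (le_trans (ltW c2)).
have /open_squareP /(_ e) : open_square (y t) by apply: oy; rewrite t0.
by rewrite E pmulr_lgt0 // ltNge (ltW dc).
Qed.

Lemma flow_exits y (T : R) e : ham_flow H y -> 0 < T ->
  (forall t, 0 < t < T -> open_square (y t)) ->
  in_edge e (y T) -> dgap H e (y T) != 0 -> dgap H e (y T) < 0.
Proof.
move=> fy T0 oy pe; rewrite neq_lt => /orP[//|dp].
have [r r0 hr] := edge_nbhs_in Hsmooth pe dp.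
have cy : pcontinuous y by case: fy.
have [d d0 hd] := flow_near T cy r0.
pose t := T - Num.min d (T / 2).
have m0 : 0 < Num.min d (T / 2) by rewrite lt_min d0 divr_gt0.
have [md mT] : Num.min d (T / 2) <= d /\ Num.min d (T / 2) <= T / 2.
  by split; rewrite ge_min lexx ?orbT.
have tT : 0 < t < T by rewrite /t; clear -m0 mT T0; lra.
have [t0 tT'] := andP tT.
have [c /andP[c1 c2]] := @gap_MVT _ H e y t T fy (ltW t0) tT'.
case: pe => -> _; rewrite sub0r => E.
have [|dc _] := hr (y c).
  apply: hd; rewrite ltr0_norm ?subr_lt0 // opprB; apply: le_trans md.
  by move: c1; rewrite /t; clear; lra.
have /open_squareP /(_ e) : open_square (y t) by exact: oy.
rewrite -oppr_lt0 E pmulr_llt0 ?subr_gt0 // => h.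
by move: dc; rewrite ltNge (ltW h).
Qed.

(** The component of X_H normal to an edge is, up to sign, the derivative of [H] along it. It has no
    zero near [q], so Rolle's argument makes [H] injective on that piece of the edge. *)
Lemma edge_level_unique e q (r : R) :
  (forall w, ball q r w -> dgap H e w < 0 /\ forall e', e' != e -> 0 < gap e' w) ->
  forall u w, ball q r u -> ball q r w -> gap e u = 0 -> gap e w = 0 ->
  H u = H w -> u = w.
Proof.
move=> hq.
have noc u : ball q r u -> gap e u = 0 -> dgap H e u < 0 /\ clamp2 u = u.
  move=> /hq[du gu] g0; split => //; apply: clamp2_id; apply/closed_squareP => e'.
  by have [->|/gu/ltW//] := eqVneq e' e; rewrite g0.
case: Hsmooth => _ _ _ _ dH.
have between (a b c x : R) : `|x - a| < r -> `|x - b| < r -> a < c < b -> `|x - c| < r.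
  by rewrite !ltr_norml; clear; lra.
case: e hq noc => -[] h hq noc.
  have main (s a b : R) : ball q r (s, a) -> ball q r (s, b) ->
      gap (true, h) (s, a) = 0 -> H (s, a) = H (s, b) -> ~ a < b.
    move=> [qs qa] [_ qb] g0 Hab ab.
    have dHs (t : R) : is_derive t 1 (fun t => H (s, t)) (partial_y H (s, t)).
      have := dH (cst s) id t 0 1 (is_derive_cst _ _ _) (is_derive_id _ _).
      by rewrite mulr0 mulr1 add0r.
    have [|c] := @MVT R (fun t => H (s, t)) (fun t => partial_y H (s, t)) a b ab.
      exact: derivable_within_continuous_itv dHs.
    rewrite in_itv /= => cab; rewrite Hab subrr => /esym/eqP.
    rewrite mulf_eq0 subr_eq0 (gt_eqF ab) orbF => /eqP P0.
    have qc : ball q r (s, c) by split => //; exact: between qa qb cab.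
    have [] := noc (s, c) qc g0 => + cE; rewrite /dgap /ham1 cE /=.
    by rewrite P0 oppr0; case: ifP; rewrite ?oppr0 ltxx.
  move=> [u1 u2] [w1 w2] bu bw gu gw.
  have uw : u1 = w1 by move: gu gw; rewrite /gap /=; case: h {hq noc main} => /=; clear; lra.
  rewrite uw in bu gu * => Huw; congr pair; apply/eqP; rewrite eq_le !leNgt.
  by apply/andP; split; apply/negP; [exact: (main w1 w2 u2 bw bu gw) | exact: (main w1 u2 w2 bu bw gu)].
have main (s a b : R) : ball q r (a, s) -> ball q r (b, s) ->
    gap (false, h) (a, s) = 0 -> H (a, s) = H (b, s) -> ~ a < b.
  move=> [qa qs] [qb _] g0 Hab ab.
  have dHs (t : R) : is_derive t 1 (fun t => H (t, s)) (partial_x H (t, s)).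
    have := dH id (cst s) t 1 0 (is_derive_id _ _) (is_derive_cst _ _ _).
    by rewrite mulr0 mulr1 addr0.
  have [|c] := @MVT R (fun t => H (t, s)) (fun t => partial_x H (t, s)) a b ab.
    exact: derivable_within_continuous_itv dHs.
  rewrite in_itv /= => cab; rewrite Hab subrr => /esym/eqP.
  rewrite mulf_eq0 subr_eq0 (gt_eqF ab) orbF => /eqP P0.
  have qc : ball q r (c, s) by split => //; exact: between qa qb cab.
  have [] := noc (c, s) qc g0 => + cE; rewrite /dgap /ham2 cE /=.
  by rewrite P0; case: ifP; rewrite ?oppr0 ltxx.
move=> [u1 u2] [w1 w2] bu bw gu gw.
have uw : u2 = w2 by move: gu gw; rewrite /gap /=; case: h {hq noc main} => /=; clear; lra.
rewrite uw in bu gu * => Huw; congr pair; apply/eqP; rewrite eq_le !leNgt.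
by apply/andP; split; apply/negP; [exact: (main w2 w1 u1 bw bu gw) | exact: (main w2 u1 w1 bu bw gu)].
Qed.

(** The end [q'] is prescribed, whereas the flow only provides some end near [q]. Both carry the
    value [H p'], so [edge_level_unique] identifies them. *)
Lemma arc_perturbation p q A ep eq (eps : R) : trajectory_arc H p q A ->
  in_edge ep p -> in_edge eq q -> dgap H ep p != 0 -> dgap H eq q != 0 -> 0 < eps ->
  exists2 d, 0 < d & forall p' q', gap ep p' = 0 -> gap eq q' = 0 ->
    ball p d p' -> ball q d q' -> H p' = H q' ->
    exists2 A', trajectory_arc H p' q' A' &
      forall w, A' w -> exists2 u, A u & ball u eps w.
Proof.
move=> /trajectory_arc_flowE[T [phi [T0 fphi ophi [phi0 phiT] ->]]].
rewrite -{}phi0 -{}phiT => pe qe /(flow_enters fphi T0 ophi pe) dp.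
move=> /(flow_exits fphi T0 ophi qe) dq eps0.
have [r r0 hr] := edge_nbhs_out Hsmooth qe dq.
have [s s0 hs] := edge_nbhs_in Hsmooth pe dp.
have [m m0 [mr me]] : exists2 m, 0 < m & m <= r /\ m <= eps.
  exists (Num.min r eps); first by rewrite lt_min r0.
  by split; rewrite ge_min lexx ?orbT.
have [d d0 hd] := flow_perturbation Hsmooth fphi T0 ophi pe qe dp dq m0.
(* Besides the flow estimate through [d], the bound [m] puts [q'] where [H] is injective, and [s]
   keeps [p'] away from the other edges. *)
pose d' := Num.min (Num.min d m) s.
have d'0 : 0 < d' by rewrite !lt_min d0 m0 s0.
have [d'd d'm d's] : [/\ d' <= d, d' <= m & d' <= s].
  by split; rewrite !ge_min lexx ?orbT.
exists d' => // p' q' gp' gq' bp' bq' Hpq'.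
have [y fy y0] := ham_flow_exists Hsmooth p'.
have [||T' [T'0 oy gT' bT' clos]] := hd y fy; first by rewrite y0.
  by rewrite y0; exact: le_ball bp'.
have cq' : closed_square (y T').
  have [_ gu] := hr (y T') (le_ball mr bT').
  apply/closed_squareP => e; have [->|/gu/ltW//] := eqVneq e eq.
  by rewrite gT'.
have cp' : closed_square p'.
  have [_ gu] := hs p' (le_ball d's bp').
  apply/closed_squareP => e; have [->|/gu/ltW//] := eqVneq e ep.
  by rewrite gp'.
have arc := trajectory_arc_flow T'0 fy oy; rewrite y0 in arc.
have HT' := trajectory_arc_conserved arc cp' cq'.
have yT' : y T' = q'.
  apply: (edge_level_unique hr (le_ball mr bT')) => //.
    by apply: (le_ball mr); exact: le_ball bq'.
  by rewrite HT' Hpq'.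
exists (y @` `[0, T']); first by rewrite -yT'.
move=> _ [t tT' <-]; rewrite /= in_itv /= in tT'.
have [u uT bu] := clos t tT'; exists (phi u); last exact: le_ball bu.
by exists u => //; rewrite /= in_itv.
Qed.

End Arcs.

(** * Loops on the torus *)

Section TorusImages.
Variable R : realType.
Implicit Types (u v w : R * R) (A K : set (R * R)) (U G : set (torus R)).

Lemma square_point u : closed_square u -> exists x : @closed_square R, set_val x = u.
Proof. by move=> cu; exists (exist _ u (mem_set cu)); rewrite set_valE. Qed.

Lemma square_to_torus_eq (x y : @closed_square R) :
  square_to_torus x = square_to_torus y <->
  glue_edges (set_val x) = glue_edges (set_val y).
Proof.
split=> [/eqmodP /eqP //|xy]; apply/eqmodP; exact/eqP.
Qed.

Lemma torus_imageP A (x : @closed_square R) : torus_image A (square_to_torus x) <->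
  exists2 u, closed_square u /\ A u & glue_edges u = glue_edges (set_val x).
Proof.
split=> [[y Ay /square_to_torus_eq yx]|[u [cu Au] ux]].
  by exists (set_val y) => //; split => //; exact: set_valP.
have [y yu] := square_point cu; exists y; first by rewrite /preimage /= yu.
by apply/square_to_torus_eq; rewrite yu.
Qed.

Lemma compact_tube K (O : set (R * R)) : compact K -> open O -> K `<=` O ->
  exists2 e : R, 0 < e & forall u w, K u -> ball u e w -> O w.
Proof.
move=> /compact_near_coveringP cK oO KO.
have : \forall e \near (0 : R)^'+, K `<=` [set u | forall w, ball u e w -> O w].
  apply: (cK R (0^'+) (fun e u => forall w, ball u e w -> O w)) => u Ku.
  have /nbhs_ballP[r /= r0 rO] : nbhs u O by move: oO; rewrite openE => /(_ u (KO u Ku)).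
  have r20 : 0 < r / 2 by rewrite divr_gt0.
  exists (ball u (r / 2), [set e | e < r / 2]).
    split; first exact: nbhsx_ballx.
    exact: nbhs_right_lt.
  move=> [v e] [/= bv er] w bw; apply: rO; rewrite [r]splitr.
  by apply: ball_triangle bv _; apply: le_ball bw; exact: ltW.
move=> h; near (0 : R)^'+ => e.
exists e; first by near: e; exact: nbhs_right_gt.
have he : K `<=` [set u | forall w, ball u e w -> O w] by near: e.
by move=> u w /he; apply.
Unshelve. all: by end_near. Qed.

(** An open set of the quotient pulls back to a relatively open set of the square; [W] extends it to
    the plane, where compactness gives a uniform margin. Points of [A] outside the square do not
    contribute to [torus_image A]. *)
Lemma torus_tube K U : compact K -> K `<=` @closed_square R -> open U ->
  torus_image K `<=` U ->
  exists2 e : R, 0 < e & forall A, (forall w, A w -> exists2 u, K u & ball u e w) ->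
    torus_image A `<=` U.
Proof.
move=> cK Ksq oU KU.
have [W oW WE] : exists2 W : set (R * R), open W &
    set_val @^-1` W = @square_to_torus R @^-1` U.
  by have : open (@square_to_torus R @^-1` U) by exact: oU.
have KW : K `<=` W.
  move=> u Ku; have [x xu] := square_point (Ksq u Ku).
  suff : (set_val @^-1` W) x by rewrite /preimage /= xu.
  rewrite WE; apply: KU; apply/torus_imageP; exists u; rewrite ?xu //.
  by split => //; exact: Ksq.
have [e e0 he] := compact_tube cK oW KW; exists e => // A hA _ [x Ax <-].
have [u Ku bu] := hA _ Ax.
suff : (set_val @^-1` W) x by rewrite WE.
exact: he Ku bu.
Qed.

End TorusImages.

(** * Loops of type aba and their sewing conditions *)

Section Loops.
Variables (R : realType) (H : R * R -> R).
Hypothesis Hsmooth : smooth_on_square H (partial_x H) (partial_y H).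
Implicit Types (p q u w : R * R) (x y : R) (A B : set (R * R)) (G : set (torus R)).

Lemma in_edge_left y : 0 < y < 1 -> in_edge (true, false) (0, y).
Proof.
by move=> /andP[a b]; split=> // -[[] []] //= _; rewrite /gap /= ?subr_gt0 ?subr0.
Qed.

Lemma in_edge_right y : 0 < y < 1 -> in_edge (true, true) (1, y).
Proof.
move=> /andP[a b]; split=> [|[[] []] //= _]; by rewrite /gap /= ?subr_gt0 ?subrr.
Qed.

Lemma in_edge_bottom x : 0 < x < 1 -> in_edge (false, false) (x, 0).
Proof.
by move=> /andP[a b]; split=> // -[[] []] //= _; rewrite /gap /= ?subr_gt0 ?subr0.
Qed.

Lemma in_edge_top x : 0 < x < 1 -> in_edge (false, true) (x, 1).
Proof.
move=> /andP[a b]; split=> [|[[] []] //= _]; by rewrite /gap /= ?subr_gt0 ?subrr.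
Qed.

Lemma glue_edges_open u : open_square u -> glue_edges u = u.
Proof.
case: u => a b [/= /andP[_ a1] /andP[_ b1]].
by rewrite /glue_edges /= (lt_eqF a1) (lt_eqF b1).
Qed.

Lemma glue_edges_vertical u y : 0 < y < 1 -> glue_edges u = (0, y) ->
  u = (0, y) \/ u = (1, y).
Proof.
case: u => a b /andP[y0 _]; rewrite /glue_edges /= => -[+ +].
have [->|_] := eqVneq a 1; have [->|_] := eqVneq b 1.
- by move=> _ y0'; move: y0; rewrite -y0' ltxx.
- by move=> _ ->; right.
- by move=> _ y0'; move: y0; rewrite -y0' ltxx.
- by move=> -> ->; left.
Qed.

Lemma glue_edges_horizontal u x : 0 < x < 1 -> glue_edges u = (x, 0) ->
  u = (x, 0) \/ u = (x, 1).
Proof.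
case: u => a b /andP[x0 _]; rewrite /glue_edges /= => -[+ +].
have [->|_] := eqVneq a 1; have [->|_] := eqVneq b 1.
- by move=> x0'; move: x0; rewrite -x0' ltxx.
- by move=> x0'; move: x0; rewrite -x0' ltxx.
- by move=> -> _; right.
- by move=> -> ->; left.
Qed.

Lemma glue_left_right y : 0 < y < 1 -> glue_edges (1, y) = (0, y) :> R * R.
Proof. by move=> /andP[_ y1]; rewrite /glue_edges /= eqxx (lt_eqF y1). Qed.

Lemma glue_left y : 0 < y < 1 -> glue_edges (0, y) = (0, y) :> R * R.
Proof.
by move=> /andP[_ y1]; rewrite /glue_edges /= (lt_eqF y1) eq_sym oner_eq0.
Qed.

Lemma glue_bottom x : 0 < x < 1 -> glue_edges (x, 0) = (x, 0) :> R * R.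
Proof.
by move=> /andP[_ y1]; rewrite /glue_edges /= (lt_eqF y1) eq_sym oner_eq0.
Qed.

Lemma glue_top x : 0 < x < 1 -> glue_edges (x, 1) = (x, 0) :> R * R.
Proof. by move=> /andP[_ y1]; rewrite /glue_edges /= eqxx (lt_eqF y1). Qed.

(** The flag [b] allows both time directions of a loop to be treated at once, with fixed names for
    the end points. *)
Definition oriented_arc (b : bool) p q A :=
  if b then trajectory_arc H p q A else trajectory_arc H q p A.

Lemma trajectory_arc_points p q A : trajectory_arc H p q A ->
  [/\ A p, A q & forall u, A u -> [\/ u = p, u = q | open_square u]].
Proof.
move=> [T [f [T0 _ ho [f0 fT] ->]]]; split.
- by exists 0 => //=; rewrite in_itv /= lexx ltW.
- by exists T => //=; rewrite in_itv /= lexx ltW.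
move=> _ [t + <-]; rewrite /= in_itv /= !le_eqVlt => /andP[].
move=> /predU1P[<- _|t0 /predU1P[->|tT]]; [exact: Or31 | exact: Or32 |].
by apply: Or33; have [|//] := ho t; rewrite t0.
Qed.

Lemma arc_points b p q A : oriented_arc b p q A ->
  [/\ A p, A q & forall u, A u -> [\/ u = p, u = q | open_square u]].
Proof.
case: b => /trajectory_arc_points[a c h]; split => // u /h[]; by constructor.
Qed.

Lemma arc_closed_square b p q A : oriented_arc b p q A -> closed_square p ->
  closed_square q -> A `<=` @closed_square R.
Proof.
move=> /arc_points[_ _ h] cp cq u /h[-> //|-> //|[/andP[a c] /andP[d e]]].
by split; rewrite !ltW.
Qed.

Lemma arc_compact b p q A : oriented_arc b p q A -> compact A.
Proof.
by case: b => -[T [f [T0 cf _ _ ->]]]; apply: continuous_compact => //;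
  exact: segment_compact.
Qed.

Lemma arc_conserved b p q A : oriented_arc b p q A -> closed_square p ->
  closed_square q -> H p = H q.
Proof.
by case: b => h cp cq; [rewrite (trajectory_arc_conserved Hsmooth h) |
  rewrite -(trajectory_arc_conserved Hsmooth h)].
Qed.

Lemma arc_perturbation_sym b p q A ep eq (eps : R) : oriented_arc b p q A ->
  in_edge ep p -> in_edge eq q -> dgap H ep p != 0 -> dgap H eq q != 0 -> 0 < eps ->
  exists2 d, 0 < d & forall p' q', gap ep p' = 0 -> gap eq q' = 0 ->
    ball p d p' -> ball q d q' -> H p' = H q' ->
    exists2 A', oriented_arc b p' q' A' & forall w, A' w -> exists2 u, A u & ball u eps w.
Proof.
case: b => h pe qe dp dq eps0; first exact: (arc_perturbation Hsmooth h pe qe).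
have [d d0 hd] := arc_perturbation Hsmooth h qe pe dq dp eps0.
exists d => // p' q' gp gq bp bq Hpq; exact: hd.
Qed.

Definition sewn x y : Prop :=
  0 < partial_y H (0, y) * partial_y H (1, y) /\
  0 < partial_x H (x, 0) * partial_x H (x, 1).

Definition aba_loop b x y A B := oriented_arc b (0, y) (x, 1) A /\ oriented_arc b (x, 0) (1, y) B.

Lemma aba_typeE x y G : aba_type H x y G ->
  [/\ 0 < x < 1, 0 < y < 1 &
    exists b A B, aba_loop b x y A B /\ G = torus_image (A `|` B)].
Proof.
move=> [x01 y01 [A [B [GE [[hA hB]|[hA hB]]]]]]; split => //.
  by exists true, A, B.
by exists false, A, B.
Qed.

Lemma left_closed y : 0 < y < 1 -> closed_square (0, y).
Proof. by move=> /in_edge_left; exact: in_edge_closed_square. Qed.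

Lemma right_closed y : 0 < y < 1 -> closed_square (1, y).
Proof. by move=> /in_edge_right; exact: in_edge_closed_square. Qed.

Lemma bottom_closed x : 0 < x < 1 -> closed_square (x, 0).
Proof. by move=> /in_edge_bottom; exact: in_edge_closed_square. Qed.

Lemma top_closed x : 0 < x < 1 -> closed_square (x, 1).
Proof. by move=> /in_edge_top; exact: in_edge_closed_square. Qed.

Lemma aba_loop_closing b x y A B : 0 < x < 1 -> 0 < y < 1 ->
  aba_loop b x y A B -> H (0, y) = H (x, 1) /\ H (x, 0) = H (1, y).
Proof.
move=> x01 y01 [hA hB]; split.
  by apply: (arc_conserved hA); [exact: left_closed | exact: top_closed].
by apply: (arc_conserved hB); [exact: bottom_closed | exact: right_closed].
Qed.

(* A point of the orbit glued to a boundary point is an end of an arc. *)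
Lemma crossing_sewing G (z : @closed_square R) : crossing_closed_orbit H G ->
  G (square_to_torus z) -> (forall u, glue_edges u = glue_edges (set_val z) ->
    ~ open_square u) ->
  exists2 u, glue_edges u = glue_edges (set_val z) & sewing H u.
Proof.
move=> [m [p [q [A [arcs sew _ ->]]]]] /torus_imageP[u [cu [i _ Au]] uz] nz.
exists u => //; have [_ _ ends] := trajectory_arc_points (arcs i).
by have [sp sq] := sew i; case: (ends u Au) => [->|->|/(nz u uz)].
Qed.

(** The arcs witnessing [crossing_closed_orbit] need not be those of the type. Every point of a
    glued class on the boundary is an arc end in any decomposition, so sewing transfers. *)
Lemma crossing_aba_sewn G x y : crossing_closed_orbit H G -> aba_type H x y G ->
  sewn x y.
Proof.
move=> cG /aba_typeE[x01 y01 [b [A [B [[hA hB] GE]]]]].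
have [A1 A2 _] := arc_points hA; have [B1 B2 _] := arc_points hB.
split.
  have [z zE] := square_point (left_closed y01).
  have [||u] := crossing_sewing (z := z) cG.
  - rewrite GE; apply/torus_imageP; exists (0, y); rewrite ?zE //.
    by split; [exact: left_closed | left].
  - rewrite zE glue_left // => u /(glue_edges_vertical y01)[]-> [/=];
      by rewrite ltxx ?andbF.
  rewrite zE glue_left // => /(glue_edges_vertical y01) uE.
  by case: uE => ->; rewrite /sewing /inner /= ltxx ?andbF => -[[//]|[_ _]];
    rewrite !mulr1 !mulr0 !addr0 mulrNN.
have [z zE] := square_point (bottom_closed x01).
have [||u] := crossing_sewing (z := z) cG.
- rewrite GE; apply/torus_imageP; exists (x, 0); rewrite ?zE //.
  by split; [exact: bottom_closed | right].
- rewrite zE glue_bottom // => u /(glue_edges_horizontal x01)[]-> [_ /=];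
    by rewrite ltxx ?andbF.
rewrite zE glue_bottom // => /(glue_edges_horizontal x01) uE.
by case: uE => ->; rewrite /sewing /inner /= ltxx ?andbF => -[[_ _]|[//]];
  rewrite !mulr1 !mulr0 !add0r.
Qed.

Lemma aba_loop_crossing b x y A B : 0 < x < 1 -> 0 < y < 1 -> sewn x y ->
  aba_loop b x y A B -> crossing_closed_orbit H (torus_image (A `|` B)).
Proof.
move=> x01 y01 [sy sx] [hA hB].
pose P (i : 'I_2) : R * R := if i == ord0 then (0, y) else (x, 0).
pose Q (i : 'I_2) : R * R := if i == ord0 then (x, 1) else (1, y).
pose S (i : 'I_2) := if i == ord0 then A else B.
have sewV u : u = (0, y) \/ u = (1, y) -> sewing H u.
  by case=> ->; right; split; rewrite /inner /= ?mulr1 ?mulr0 ?addr0 ?mulrNN //;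
    [left | right].
have sewH u : u = (x, 0) \/ u = (x, 1) -> sewing H u.
  by case=> ->; left; split; rewrite /inner /= ?mulr1 ?mulr0 ?add0r //;
    [left | right].
have sewP i : sewing H (P i).
  by rewrite /P; case: ifP => _; [apply: sewV; left | apply: sewH; left].
have sewQ i : sewing H (Q i).
  by rewrite /Q; case: ifP => _; [apply: sewH; right | apply: sewV; right].
have n10 : (1 : R) != 0 by exact: oner_neq0.
have QP i : Q i != P (ordS i) /\ glue_edges (Q i) = glue_edges (P (ordS i)).
  rewrite /P /Q; case: i => -[|[|//]] ?; rewrite -!val_eqE /=.
    by rewrite glue_top // glue_bottom // xpair_eqE (negPf n10) andbF.
  by rewrite glue_left_right // glue_left // xpair_eqE (negPf n10).
have PQ i : P i != Q (ordS i) /\ glue_edges (P i) = glue_edges (Q (ordS i)).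
  rewrite /P /Q; case: i => -[|[|//]] ?; rewrite -!val_eqE /=.
    by rewrite glue_left_right // glue_left // xpair_eqE eq_sym (negPf n10).
  by rewrite glue_top // glue_bottom // xpair_eqE [0 == 1]eq_sym (negPf n10) andbF.
have SE : A `|` B = \bigcup_i S i.
  apply/seteqP; split => [u [Au|Bu]|u [i _]]; first by exists ord0.
    by exists (lift ord0 ord0).
  by rewrite /S; case: ifP => _ ?; [left | right].
case: b hA hB => hA hB.
  exists 1%N, P, Q, S; split => //; last by rewrite SE.
  by move=> i; rewrite /P /Q /S; case: ifP.
(* In the other time direction the arcs run from [Q] to [P], and [PQ] provides the gluing. *)
exists 1%N, Q, P, S; split => //; last by rewrite SE.
by move=> i; rewrite /P /Q /S; case: ifP.
Qed.

End Loops.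

(** * Isolation and uniqueness of the cycles *)

Section Isolation.
Variables (R : realType) (H : R * R -> R).
Hypothesis Hsmooth : smooth_on_square H (partial_x H) (partial_y H).
Implicit Types (p q u w : R * R) (x y : R) (A B : set (R * R)) (G : set (torus R)).

Lemma dgap_edges x y : 0 < x < 1 -> 0 < y < 1 ->
  [/\ dgap H (true, false) (0, y) = - partial_y H (0, y),
      dgap H (true, true) (1, y) = partial_y H (1, y),
      dgap H (false, false) (x, 0) = partial_x H (x, 0) &
      dgap H (false, true) (x, 1) = - partial_x H (x, 1)].
Proof.
move=> x01 y01; rewrite /dgap /ham1 /ham2 /=; split.
- by rewrite clamp2_id //; exact: left_closed.
- by rewrite opprK clamp2_id //; exact: right_closed.
- by rewrite clamp2_id //; exact: bottom_closed.
- by rewrite clamp2_id //; exact: top_closed.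
Qed.

Lemma positive_nearby (k : R -> R) x : {for x, continuous k} -> 0 < k x ->
  exists2 e, 0 < e & forall t, `|t - x| < e -> 0 < k t.
Proof.
move=> ck k0; have /nbhs_ballP[e /= e0 he] : \forall t \near x, 0 < k t.
  exact: (cvgr_gt _ ck).
by exists e => // t xt; apply: he; rewrite /ball /= distrC.
Qed.

Lemma pair_continuousl (f : R * R -> R) (c : R) : continuous f ->
  continuous (fun t => f (c, t)).
Proof.
move=> cf t; apply: (@continuous_comp _ _ _ (fun t => (c, t)) f); last exact: cf.
have h1 : (fun _ : R => c) @ nbhs t --> c by exact: cvg_cst.
have h2 : (fun s : R => s) @ nbhs t --> t by exact: cvg_id.
exact: (cvg_pair h1 h2).
Qed.

Lemma pair_continuousr (f : R * R -> R) (c : R) : continuous f ->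
  continuous (fun t => f (t, c)).
Proof.
move=> cf t; apply: (@continuous_comp _ _ _ (fun t => (t, c)) f); last exact: cf.
have h1 : (fun _ : R => c) @ nbhs t --> c by exact: cvg_cst.
have h2 : (fun s : R => s) @ nbhs t --> t by exact: cvg_id.
exact: (cvg_pair h2 h1).
Qed.

Lemma sewn_nearby x1 y1 : 0 < x1 < 1 -> 0 < y1 < 1 -> sewn H x1 y1 ->
  exists2 e, 0 < e & forall x y, `|x - x1| < e -> `|y - y1| < e ->
    [/\ 0 < x < 1, 0 < y < 1 & sewn H x y].
Proof.
move=> x01 y01 [sy sx].
have [E1 E2 E3 E4] := dgap_edges x01 y01.
have [||e1 e10 h1] := @positive_nearby
    (fun t => dgap H (true, false) (0, t) * - dgap H (true, true) (1, t)) y1.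
- apply: cvgM; first by apply: pair_continuousl; exact: dgap_continuous.
  by apply: cvgN; apply: pair_continuousl; exact: dgap_continuous.
- by rewrite E1 E2 mulrNN.
have [||e2 e20 h2] := @positive_nearby
    (fun t => dgap H (false, false) (t, 0) * - dgap H (false, true) (t, 1)) x1.
- apply: cvgM; first by apply: pair_continuousr; exact: dgap_continuous.
  by apply: cvgN; apply: pair_continuousr; exact: dgap_continuous.
- by rewrite E3 E4 opprK.
have in01 (c : R) : 0 < c < 1 -> exists2 e, 0 < e & forall t, `|t - c| < e -> 0 < t < 1.
  move=> /andP[c0 c1]; exists (Num.min c (1 - c)); first by rewrite lt_min c0 subr_gt0.
  move=> t; rewrite lt_min !ltr_norml => /andP[/andP[a _] /andP[_ d]].
  by apply/andP; split; clear -a d; lra.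
have [e3 e30 h3] := in01 x1 x01; have [e4 e40 h4] := in01 y1 y01.
exists (Num.min (Num.min e1 e2) (Num.min e3 e4)); first by rewrite !lt_min e10 e20 e30 e40.
move=> x y; rewrite !lt_min => /andP[/andP[_ x2] /andP[x3 _]].
move=> /andP[/andP[y1' _] /andP[_ y4]].
have x01' := h3 x x3; have y01' := h4 y y4; split => //.
have [F1 F2 F3 F4] := dgap_edges x01' y01'.
split; first by have := h1 y y1'; rewrite F1 F2 mulrNN.
by have := h2 x x2; rewrite F3 F4 opprK.
Qed.

(** The loop meets the glued vertical edges in a single class, so its image on the torus determines
    the height [y]. *)
Lemma torus_image_left b x y A B y' : 0 < x < 1 -> 0 < y < 1 -> 0 < y' < 1 ->
  aba_loop H b x y A B ->
  forall u, (A `|` B) u -> glue_edges u = (0, y') -> y = y'.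
Proof.
move=> x01 y01 y'01 [hA hB] u.
have [_ _ A3] := arc_points hA; have [_ _ B3] := arc_points hB.
have x0 : x != 0 by case/andP: x01 => x0 _; rewrite gt_eqF.
have op v : open_square v -> glue_edges v <> (0, y').
  move=> ov; rewrite glue_edges_open // => vE.
  by move: ov; rewrite vE => -[/=]; rewrite ltxx.
case=> [/A3|/B3] [->|->|/op//].
- by rewrite glue_left // => -[].
- by rewrite glue_top // => -[] /eqP; rewrite (negPf x0).
- by rewrite glue_bottom // => -[] /eqP; rewrite (negPf x0).
- by rewrite glue_left_right // => -[].
Qed.

(** Only the heights are compared, since [torus_image_left] reads off just that coordinate; it
    suffices because [common_factor_not_isolated] produces a solution at another height. *)
Lemma limit_cycle_isolated G x1 y1 : limit_cycle H G -> aba_type H x1 y1 G ->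
  exists2 e, 0 < e & forall x y, `|x - x1| < e -> `|y - y1| < e ->
    H (0, y) = H (x, 1) -> H (x, 0) = H (1, y) -> y = y1.
Proof.
move=> [cG [U [oU GU Uuniq]]] tG; have s1 := crossing_aba_sewn cG tG.
have [x01 y01 [b [A [B [hAB GE]]]]] := aba_typeE tG; have [hA hB] := hAB.
have [E1 E2 E3 E4] := dgap_edges x01 y01.
have [d1 d2 d3 d4] : [/\ dgap H (true, false) (0, y1) != 0,
    dgap H (true, true) (1, y1) != 0, dgap H (false, false) (x1, 0) != 0 &
    dgap H (false, true) (x1, 1) != 0].
  rewrite E1 E2 E3 E4 !oppr_eq0; case: s1 => /lt0r_neq0 + /lt0r_neq0.
  by rewrite !mulf_eq0 !negb_or => /andP[-> ->] /andP[-> ->].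
have cA := arc_closed_square hA (left_closed y01) (top_closed x01).
have cB := arc_closed_square hB (bottom_closed x01) (right_closed y01).
have [||||eps eps0 heps] := @torus_tube _ (A `|` B) U.
- by apply: compactU; [exact: arc_compact hA | exact: arc_compact hB].
- by move=> u [/cA|/cB].
- exact: oU.
- by rewrite -GE.
have [e1 e10 pA] := arc_perturbation_sym Hsmooth hA (in_edge_left y01)
  (in_edge_top x01) d1 d4 eps0.
have [e2 e20 pB] := arc_perturbation_sym Hsmooth hB (in_edge_bottom x01)
  (in_edge_right y01) d3 d2 eps0.
have [e3 e30 hs] := sewn_nearby x01 y01 s1.
exists (Num.min (Num.min e1 e2) e3); first by rewrite !lt_min e10 e20 e30.
move=> x y; rewrite !lt_min => /andP[/andP[x1' x2] x3] /andP[/andP[y1' y2] y3] HA HB.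
have [x01' y01' sxy] := hs x y x3 y3.
have b0 (e : R) : 0 < e -> forall c : R, ball c e c by move=> e0' c; exact: ballxx.
have bl (c t e : R) : `|t - c| < e -> ball c e t by rewrite /ball /= distrC.
have [||||A' hA' nA] := pA (0, y) (x, 1) _ _ _ _ HA.
- by case: (in_edge_left y01').
- by case: (in_edge_top x01').
- by split; [exact: b0 | exact: bl].
- by split; [exact: bl | exact: b0].
have [||||B' hB' nB] := pB (x, 0) (1, y) _ _ _ _ HB.
- by case: (in_edge_bottom x01').
- by case: (in_edge_right y01').
- by split; [exact: bl | exact: b0].
- by split; [exact: b0 | exact: bl].
have hAB' : aba_loop H b x y A' B' by split.
have cG' := aba_loop_crossing x01' y01' sxy hAB'.
have G'U : torus_image (A' `|` B') `<=` U.
  apply: heps => w [/nA[u Au bu]|/nB[u Bu bu]]; exists u => //; first by left.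
  by right.
have G'G := Uuniq _ cG' G'U.
have [z zE] := square_point (left_closed y01').
have : torus_image (A' `|` B') (square_to_torus z).
  apply/torus_imageP; exists (0, y); last by rewrite zE.
  by split; [exact: left_closed | left; have [] := arc_points hA'].
rewrite G'G GE => /torus_imageP[u [_ ABu]]; rewrite zE glue_left // => uE.
by rewrite (torus_image_left x01 y01 y01' hAB ABu uE).
Qed.

(** The sign of the normal component at [p] tells whether the arc starts or ends there. Two cycles
    through the same transition points therefore run in the same direction. *)
Lemma arc_direction b p q A e : oriented_arc H b p q A -> in_edge e p -> dgap H e p != 0 ->
  b = (0 < dgap H e p).
Proof.
case: b => /(trajectory_arc_flowE Hsmooth)[T [f [T0 ff ho [f0 fT] _]]] pe dp.
  by move: pe dp; rewrite -f0 => pe dp; rewrite (flow_enters Hsmooth ff T0 ho pe dp).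
move: pe dp; rewrite -fT => pe dp.
by apply/esym/negbTE; rewrite -leNgt ltW // (flow_exits Hsmooth ff T0 ho pe dp).
Qed.

Lemma edge_not_open e p : in_edge e p -> ~ open_square p.
Proof. by move=> [p0 _] /open_squareP /(_ e); rewrite p0 ltxx. Qed.

Lemma arc_unique b p q A A' e e' : in_edge e p -> in_edge e' q ->
  oriented_arc H b p q A -> oriented_arc H b p q A' -> A = A'.
Proof.
move=> pe qe; case: b => h h'.
  exact: (trajectory_arc_unique Hsmooth h h' (edge_not_open qe) (edge_not_open qe)).
exact: (trajectory_arc_unique Hsmooth h h' (edge_not_open pe) (edge_not_open pe)).
Qed.

Lemma aba_cycle_unique G G' x y : crossing_closed_orbit H G -> aba_type H x y G ->
  aba_type H x y G' -> G = G'.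
Proof.
move=> cG tG /aba_typeE[x01 y01 [b' [A' [B' [[hA' hB'] ->]]]]].
have [sy sx] := crossing_aba_sewn cG tG.
move: tG => /aba_typeE[_ _ [b [A [B [[hA hB] ->]]]]].
have [E1 _ _ _] := dgap_edges x01 y01.
have d1 : dgap H (true, false) (0, y) != 0.
  by rewrite E1 oppr_eq0; apply: contraTneq sy => ->; rewrite mul0r ltxx.
have bb' : b' = b.
  by rewrite (arc_direction hA (in_edge_left y01) d1)
             (arc_direction hA' (in_edge_left y01) d1).
rewrite bb' in hA' hB'.
rewrite (arc_unique (in_edge_left y01) (in_edge_top x01) hA hA').
by rewrite (arc_unique (in_edge_bottom x01) (in_edge_right y01) hB hB').
Qed.

End Isolation.

(** * Counting *)

Section EdgePolynomials.
Variables (R : realType) (n : nat) (a : nat -> nat -> R).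

Definition poly_row (c : R) : {poly R} :=
  \sum_(1 <= k < n.+1) \sum_(0 <= j < k.+1) (a k j * c ^+ j) *: 'X^(k - j).

Definition poly_col (c : R) : {poly R} :=
  \sum_(1 <= k < n.+1) \sum_(0 <= j < k.+1) (a k j * c ^+ (k - j)) *: 'X^j.

Lemma horner_poly_row c x : (poly_row c).[x] = poly_fun n a (x, c).
Proof.
rewrite /poly_row /poly_fun horner_sum; apply: eq_bigr => k _.
rewrite horner_sum; apply: eq_bigr => j _.
by rewrite hornerZ hornerXn mulrAC.
Qed.

Lemma horner_poly_col c y : (poly_col c).[y] = poly_fun n a (c, y).
Proof.
rewrite /poly_col /poly_fun horner_sum; apply: eq_bigr => k _.
rewrite horner_sum; apply: eq_bigr => j _.
by rewrite hornerZ hornerXn.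
Qed.

Lemma size_sum_XnZ (c : nat -> nat -> R) (d : nat -> nat -> nat) m :
  (forall k j, (0 < k <= n)%N -> (j <= k)%N -> c k j != 0 -> (d k j < m)%N) ->
  (size (\sum_(1 <= k < n.+1) \sum_(0 <= j < k.+1) c k j *: 'X^(d k j) : {poly R})%R
    <= m)%N.
Proof.
move=> cd; rewrite big_nat_cond; apply: (big_ind (fun p : {poly R} => (size p <= m)%N)).
- by rewrite size_poly0.
- by move=> p q pm qm; rewrite (leq_trans (size_polyD _ _)) // geq_max pm.
move=> k /andP[kn _]; rewrite big_nat_cond.
apply: (big_ind (fun p : {poly R} => (size p <= m)%N)).
- by rewrite size_poly0.
- by move=> p q pm qm; rewrite (leq_trans (size_polyD _ _)) // geq_max pm.
move=> j /andP[jk _]; have [->|c0] := eqVneq (c k j) 0.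
  by rewrite scale0r size_poly0.
by rewrite (leq_trans (size_scale_leq _ _)) // size_polyXn; apply: cd.
Qed.

Lemma size_poly_row c : (size (poly_row c) <= n.+1)%N.
Proof. by apply: size_sum_XnZ => k j kn jk _; lia. Qed.

Lemma size_poly_col c : (size (poly_col c) <= n.+1)%N.
Proof. by apply: size_sum_XnZ => k j kn jk _; lia. Qed.

(* The terms of degree [n] in [x] alone, or in [y] alone, cancel. *)
Lemma size_poly_rowB c c' : (size (poly_row c - poly_row c')%R <= n)%N.
Proof.
rewrite /poly_row -sumrB.
rewrite (eq_bigr (fun k => \sum_(0 <= j < k.+1)
    (a k j * c ^+ j - a k j * c' ^+ j) *: 'X^(k - j))); last first.
  by move=> k _; rewrite -sumrB; apply: eq_bigr => j _; rewrite scalerBl.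
apply: size_sum_XnZ => k j kn jk; case: j jk => [|j] jk.
  by rewrite !expr0 subrr eqxx.
by move=> _; lia.
Qed.

Lemma size_poly_colB c c' : (size (poly_col c - poly_col c')%R <= n)%N.
Proof.
rewrite /poly_col -sumrB.
rewrite (eq_bigr (fun k => \sum_(0 <= j < k.+1)
    (a k j * c ^+ (k - j) - a k j * c' ^+ (k - j)) *: 'X^j)); last first.
  by move=> k _; rewrite -sumrB; apply: eq_bigr => j _; rewrite scalerBl.
apply: size_sum_XnZ => k j kn jk; have [kj|kj] := eqVneq (k - j)%N 0%N.
  by rewrite kj !expr0 subrr eqxx.
by move=> _; lia.
Qed.

Lemma deriv_poly_row c x : (poly_row c)^`().[x] = partial_x (poly_fun n a) (x, c).
Proof.
rewrite /partial_x /= derive1E.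
rewrite (_ : (fun _ => _) = horner (poly_row c)); last first.
  by apply/funext => t; rewrite horner_poly_row.
by rewrite derive_val.
Qed.

End EdgePolynomials.

(** * The bound on the number of transition points *)

Section Counting.
Variables (R : realType) (n : nat) (a : nat -> nat -> R).
Let H := poly_fun n a.

Let Hsmooth : smooth_on_square H (partial_x H) (partial_y H) :=
  smooth_on_square_poly_fun n a.

Lemma aba_points_bound (s : seq (R * R)) : uniq s ->
  (forall z, z \in s -> exists2 G, limit_cycle H G & aba_type H z.1 z.2 G) ->
  (size s <= n * (n - 1))%N.
Proof.
move=> us cyc; rewrite leqNgt; apply/negP => szs.
(* [f1 - g1] is [F], and [f2 - g2] is [S], arranged so that the pure top-degree terms cancel
   separately in [x] and in [y]. *)
pose f1 := poly_row n a 1; pose g1 := poly_col n a 0.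
pose f2 := poly_row n a 1 - poly_row n a 0.
pose g2 := poly_col n a 0 - poly_col n a 1.
have f1' z : z \in s -> f1^`().[z.1] != 0.
  move=> /cyc[G [cG _] tG]; have [_] := crossing_aba_sewn cG tG.
  by rewrite /f1 deriv_poly_row => /lt0r_neq0; rewrite mulf_eq0 negb_or => /andP[].
have closing z : z \in s -> f1.[z.1] = g1.[z.2] /\ f2.[z.1] = g2.[z.2].
  move=> /cyc[G _ /aba_typeE[x01 y01 [b [A [B [hAB _]]]]]].
  have [E1 E2] := aba_loop_closing Hsmooth x01 y01 hAB.
  rewrite /f1 /g1 /f2 /g2 !hornerD !hornerN !horner_poly_row !horner_poly_col.
  by rewrite -/H E1 E2.
(* Only an inequality, because the truncated [n - 1] is 0 when [n = 0]. *)
have nE : (n <= (n - 1).+1)%N by lia.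
have [|c [d [p [q [z [zs dz F S]]]]]] := @bezout_separated R n (n - 1) f1 g1 f2 g2 s
    (size_poly_row n a 1) (size_poly_col n a 0)
    (leq_trans (size_poly_rowB n a 1 0) nE) (leq_trans (size_poly_colB n a 0 1) nE)
    _ us closing szs.
  (* If [F] vanished everywhere, [f1] would be constant, against its nonzero derivative at a point
     of [s]. *)
  case: s us cyc szs f1' closing => // z s _ _ _ f1' _.
  apply/not_existsP => h; have /eqP := f1' z (mem_head _ _); apply.
  have -> : f1 = g1.[0]%:P.
    apply: poly_eqfun => x; rewrite hornerC; apply/eqP/negPn/negP.
    exact: (h (x, 0)).
  by rewrite derivC horner0.
have [G lG tG] := cyc z zs.
have [e e0 he] := limit_cycle_isolated Hsmooth lG tG.
have [x [y [yz xz yz' E1 E2]]] := common_factor_not_isolated F S dz (f1' z zs) e0.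
move/eqP: yz; apply; apply: (he x y xz yz').
  by move: E1; rewrite /f1 /g1 horner_poly_row horner_poly_col.
move: E1 E2; rewrite /f1 /g1 /f2 /g2 !hornerD !hornerN !horner_poly_row !horner_poly_col.
by move=> -> /addrI /oppr_inj.
Qed.

End Counting.

(** A finite set is compared through its cardinal; an infinite one would receive an injection from
    the natural numbers, hence from any initial segment. *)
Lemma card_le_ordinal {T : pointedType} (S : set T) (N : nat) :
  (`I_N.+1 #<= S)%card = false -> (S #<= `I_N)%card.
Proof.
move=> nle; have [Sfin|Sinf] := pselect (finite_set S).
  have /finite_setP[k Sk] := Sfin.
  rewrite (card_le_eql Sk) card_le_II leqNgt; apply/negP => Nk.
  by move: nle; rewrite (card_le_eqr Sk) card_le_II Nk.
move: nle => /negP[]; apply: card_le_trans (_ : [set: nat] #<= S)%card.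
  exact: subset_card_le.
exact/infiniteP.
Qed.

Unset Implicit Arguments.

Theorem theorem4 (R : realType) (n : nat) (a : nat -> nat -> R)
    (H : R * R -> R)
    (H_def : H = poly_fun n a)
    (H_degree : exists j : nat, (j <= n)%N /\ a n j != 0)
    (X_nonzero : exists p : R * R, closed_square p /\ pw_field H p != 0)
    (H_origin : H (0, 0) = 0)
    (H_aba : forall (G : set (torus R)) (x1 y1 : R),
      limit_cycle H G -> aba_type H x1 y1 G ->
      (exists mu : R,
         is_min [set enorm (grad H p) | p in square_preimage G] mu /\ 0 < mu) /\
      [/\ inner (pw_field H (0, y1)) (1, 0) != 0,
          inner (pw_field H (x1, 1)) (0, -1) != 0,
          inner (pw_field H (x1, 0)) (0, 1) != 0 &
          inner (pw_field H (1, y1)) (-1, 0) != 0]) :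
  ([set G : set (torus R) | aba_limit_cycle H G] #<= `I_(n * (n - 1)))%card.
Proof.
rewrite H_def {H_def H_degree X_nonzero H_origin H_aba H}; set H := poly_fun n a.
have Hsmooth := smooth_on_square_poly_fun n a.
apply: card_le_ordinal; apply/negP => /pcard_leP[g].
have gS i : (i < (n * (n - 1)).+1)%N -> exists z : R * R,
    limit_cycle H (g i) /\ aba_type H z.1 z.2 (g i).
  by move=> iN; have [lG [x [y tG]]] := @funS _ _ _ _ g i iN; exists (x, y).
(* [choice] needs a point for every index; those out of range get a default. *)
have gS' i : exists z : R * R, (i < (n * (n - 1)).+1)%N ->
    limit_cycle H (g i) /\ aba_type H z.1 z.2 (g i).
  have [iN|iN] := ltnP i (n * (n - 1)).+1; last by exists (0, 0).
  by have [z] := gS i iN; exists z.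
have [f fP] := choice gS'.
have := @aba_points_bound R n a [seq f i | i <- iota 0 (n * (n - 1)).+1].
rewrite size_map size_iota ltnn => H1; apply: notF; apply: H1.
  (* Distinct cycles have distinct transition points, by [aba_cycle_unique]. *)
  rewrite map_inj_in_uniq ?iota_uniq // => i j; rewrite !mem_iota !add0n /= => iN jN fij.
  have [[cG _] tG] := fP i iN; have [_ tG'] := fP j jN.
  rewrite -fij in tG'.
  have gij := aba_cycle_unique Hsmooth cG tG tG'.
  by apply: (@inj _ _ _ g) gij; rewrite inE.
move=> _ /mapP[i + ->]; rewrite mem_iota add0n => iN.
by have [] := fP i iN; exists (g i).
Qed.
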